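(* Assume that there is an uncountable strongly inaccessible cardinal. The theory consisting of $\mathsf{eZF}$, $\mathsf{ECT}$, and the stability of atomics is consistent with the failure of the stability of negated atomics.
   Context: Quantified modal logic. Modal formulas are built from atomic formulas and $\bot$ by $\wedge,\vee,\Rightarrow,\forall,\exists,\Box$; $\neg\varphi$ is $\varphi\Rightarrow\bot$. The Hilbert system $Q_{eq}.\mathsf{S4}$ has as axioms: all instances of classical propositional tautologies; $\Box(\varphi\Rightarrow\psi)\Rightarrow(\Box\varphi\Rightarrow\Box\psi)$; $\Box\varphi\Rightarrow\varphi$; $\Box\varphi\Rightarrow\Box\Box\varphi$; $(\forall x\,\varphi)\Leftrightarrow\varphi$ for $x$ not free in $\varphi$; $[\forall x(\varphi\Rightarrow\psi)]\Rightarrow[(\forall x\,\varphi)\Rightarrow(\forall x\,\psi)]$; $\forall x\forall y\,\varphi\Leftrightarrow\forall y\forall x\,\varphi$; $(\forall x\,\varphi(x))\Rightarrow\varphi(y)$; $t=t$ and $s=t\Rightarrow(\varphi(t)\Rightarrow\varphi(s))$ for terms $s,t$; with $\exists x\,\varphi$ equivalent to $\neg\forall x\neg\varphi$ as usual. Its rules are modus ponens, universal generalization (from $\varphi$ infer $\forall x\,\varphi$) and necessitation (from $\varphi$ infer $\Box\varphi$). The theory $\mathsf{eZF}$, in the signature with one binary relation symbol $\in$, consists of $Q_{eq}.\mathsf{S4}$ plus the following axioms ($\varphi$ any modal formula in this signature, possibly with free parameter variables; bounded quantifiers are the usual abbreviations): I. (Modal Extensionality) $\forall x\,\forall y\,(\Box(\forall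 z\,(z\in x\Leftrightarrow z\in y))\Rightarrow x=y)$. III. (Scedrov's Modal Foundation) $[\Box\,\forall x\,(\Box(\forall y\in x\;\varphi(y))\Rightarrow\varphi(x))]\Rightarrow[\Box\,\forall x\,\varphi(x)]$. IV. (Pairing) $\forall x,y\,\exists z\,\Box(\forall u\,(u\in z\Leftrightarrow(u=x\vee u=y)))$. V. (Unions) $\forall x\,\exists y\,\Box(\forall z\,(z\in y\Leftrightarrow\exists v\,(v\in x\wedge z\in v)))$. VI$^{\Box}$. (Comprehension$^{\Box}$) $\forall x\,\exists y\,\Box(\forall z\,(z\in y\Leftrightarrow(z\in x\wedge\Box\,\varphi(z))))$. VII. (Modal Power Set) $\forall x\,\exists y\,\Box\,\forall z\,(z\in y\Leftrightarrow\Box(\forall u\,(u\in z\Rightarrow u\in x)))$. VIII. (Infinity) $\exists u\,\Box[\exists y\in u\,\Box(\forall z\;z\notin y)\wedge(\forall y\in u\,\exists z\in u\,\Box\,\forall v\,(v\in z\Leftrightarrow(v\in y\vee v=y)))]$. X$^{\Box}$. (Collection$^{\Box}$) $[\forall y\in u\,\exists z\,\Box\,\varphi(y,z)]\Rightarrow[\exists x\,\forall y\in u\,\exists z\in x\,\Box\,\varphi(y,z)]$. Stability. For a class $\Gamma$ of formulas, $\Gamma$-stability is the schema $\Box[\forall\overline{x}\,(\varphi(\overline{x})\Rightarrow\Box\,\varphi(\overline{x}))]$ for $\varphi$ in $\Gamma$. Stability of atomics (respectively negated atomics) is the case where $\Gamma$ is the class of atomic formulas (respectively negations of atomic formulas).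 $\mathsf{ECT}$ (Epistemic Church's Thesis) is the schema $$[\Box(\forall n\,\exists m\,\Box\varphi(n,m))]\Rightarrow[\exists e\,\Box\,\forall n\,\exists m\,\exists q\,(T(e,n,q)\wedge U(q,m)\wedge\Box\varphi(n,m))],$$ where $T(e,n,q)$ is Kleene's $T$-predicate (program $e$ on input $n$ halts and outputs a code $q$ for the halting computation) and $U(q,m)$ says that the computation $q$ has output value $m$. In the set-theoretic setting, $\mathsf{ECT}$ is understood to be rendered by binding all the variables $n,m,e,q$ to the set-theoretic surrogate for the natural numbers guaranteed by the Infinity axiom. *)

(* Defs.v *)
From mathcomp Require Import all_boot.
From mathcomp Require Import classical_sets cardinality.

Set Implicit Arguments.
Unset Strict Implicit.
Unset Printing Implicit Defensive.

(** A cardinal is represented by a type [K] of that cardinality.  Every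
    cardinal below [K] is the cardinal of a subset of [K], so quantifying over
    subsets of [K] loses nothing. *)

Section Inaccessible.
Local Open Scope classical_set_scope.
Local Open Scope card_scope.

Definition card_lt (T U : Type) (A : set T) (B : set U) : Prop :=
  A #<= B /\ ~ (B #<= A).

Definition strong_limit (K : Type) : Prop :=
  forall A : set K, card_lt A [set: K] ->
    card_lt [set B : set K | B `<=` A] [set: K].

Definition regular_card (K : Type) : Prop :=
  forall (I : set K) (F : K -> set K),
    card_lt I [set: K] -> (forall i, I i -> card_lt (F i) [set: K]) ->
    card_lt (\bigcup_(i in I) F i) [set: K].

Definition uncountable_strongly_inaccessible (K : Type) : Prop :=
  [/\ ~ countable [set: K], regular_card K & strong_limit K].

End Inaccessible.

(** De Bruijn indices: the variable [k] under [n > k] binders refers to the [k]-th enclosing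
    binder; the variable [n + k] is the parameter number [k].  Below, a schema
    "φ(x), possibly with parameters" is a formula whose variable [0] plays the
    role of [x]; renamings make φ skip the bound variables that must not occur
    free in it. *)

Definition var := nat.

Inductive form : Type :=
| FMem of var & var
| FEq of var & var
| FBot
| FAnd of form & form
| FOr of form & form
| FImp of form & form
| FAll of form
| FEx of form
| FBox of form.

Declare Scope modal_scope.
Delimit Scope modal_scope with modal.
Bind Scope modal_scope with form.
Local Open Scope modal_scope.

Notation "x ∈ y" := (FMem x y) (at level 70, no associativity) : modal_scope.
Notation "x ≡ y" := (FEq x y) (at level 70, no associativity) : modal_scope.
Notation "⊥" := FBot (at level 0) : modal_scope.
Notation "φ ∧ ψ" := (FAnd φ ψ) (at level 80, right associativity) : modal_scope.
Notation "φ ∨ ψ" := (FOr φ ψ) (at level 85, right associativity) : modal_scope.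
Notation "φ ⇒ ψ" := (FImp φ ψ) (at level 90, right associativity) : modal_scope.
Notation "¬ φ" := (FImp φ FBot) (at level 75, right associativity) : modal_scope.
Notation "∀' φ" := (FAll φ) (at level 75, right associativity) : modal_scope.
Notation "∃' φ" := (FEx φ) (at level 75, right associativity) : modal_scope.
Notation "□ φ" := (FBox φ) (at level 75, right associativity) : modal_scope.
Definition fiff (φ ψ : form) : form := (φ ⇒ ψ) ∧ (ψ ⇒ φ).
Notation "φ ⇔ ψ" := (fiff φ ψ) (at level 95, no associativity) : modal_scope.

(** The bound [x] is read outside the new binder. *)
Definition all_in (x : var) (φ : form) : form := ∀' (0 ∈ x.+1 ⇒ φ).
Definition ex_in (x : var) (φ : form) : form := ∃' (0 ∈ x.+1 ∧ φ).

(** [up r] is the renaming [r] seen under one more binder. *)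
Definition up (r : var -> var) (k : var) : var :=
  if k is k'.+1 then (r k').+1 else 0.

Fixpoint ren (r : var -> var) (φ : form) : form :=
  match φ with
  | FMem x y => r x ∈ r y
  | FEq x y => r x ≡ r y
  | FBot => ⊥
  | FAnd φ ψ => ren r φ ∧ ren r ψ
  | FOr φ ψ => ren r φ ∨ ren r ψ
  | FImp φ ψ => ren r φ ⇒ ren r ψ
  | FAll φ => ∀' (ren (up r) φ)
  | FEx φ => ∃' (ren (up r) φ)
  | FBox φ => □ (ren r φ)
  end.

(** φ(y), where φ(x) has [x] as variable [0]. *)
Definition inst (y : var) (φ : form) : form :=
  ren (fun k => if k is k'.+1 then k' else y) φ.

Definition swap01 (k : var) : var :=
  match k with 0 => 1 | 1 => 0 | _ => k end.

(** All free variables of φ are [< n]. *)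
Fixpoint scoped (n : nat) (φ : form) : bool :=
  match φ with
  | FMem x y | FEq x y => (x < n) && (y < n)
  | FBot => true
  | FAnd φ ψ | FOr φ ψ | FImp φ ψ => scoped n φ && scoped n ψ
  | FAll φ | FEx φ => scoped n.+1 φ
  | FBox φ => scoped n φ
  end.

(** Truth value when atomic, quantified and boxed formulas are treated as
    propositional letters. *)
Fixpoint prop_val (v : form -> bool) (φ : form) : bool :=
  match φ with
  | FBot => false
  | FAnd φ ψ => prop_val v φ && prop_val v ψ
  | FOr φ ψ => prop_val v φ || prop_val v ψ
  | FImp φ ψ => prop_val v φ ==> prop_val v ψ
  | _ => v φ
  end.

Definition tautology (φ : form) : Prop := forall v, prop_val v φ.

Inductive QeqS4_axiom : form -> Prop :=
| ax_taut φ : tautology φ -> QeqS4_axiom φ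
| ax_K φ ψ : QeqS4_axiom (□ (φ ⇒ ψ) ⇒ □ φ ⇒ □ ψ)
| ax_T φ : QeqS4_axiom (□ φ ⇒ φ)
| ax_4 φ : QeqS4_axiom (□ φ ⇒ □ □ φ)
| ax_vacuous φ : QeqS4_axiom ((∀' ren S φ) ⇔ φ)
| ax_all_imp φ ψ : QeqS4_axiom ((∀' (φ ⇒ ψ)) ⇒ (∀' φ) ⇒ (∀' ψ))
| ax_all_swap φ : QeqS4_axiom ((∀' ∀' φ) ⇔ (∀' ∀' ren swap01 φ))
| ax_all_inst φ y : QeqS4_axiom ((∀' φ) ⇒ inst y φ)
| ax_eq_refl t : QeqS4_axiom (t ≡ t)
| ax_eq_subst s t φ : QeqS4_axiom (s ≡ t ⇒ inst t φ ⇒ inst s φ)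
| ax_ex φ : QeqS4_axiom ((∃' φ) ⇔ ¬ ∀' ¬ φ).

(** Theorems of the theory with nonlogical axioms [Ax]; generalization and
    necessitation apply to the nonlogical axioms too. *)
Inductive provable (Ax : form -> Prop) : form -> Prop :=
| pr_logic φ : QeqS4_axiom φ -> provable Ax φ
| pr_axiom φ : Ax φ -> provable Ax φ
| pr_mp φ ψ : provable Ax (φ ⇒ ψ) -> provable Ax φ -> provable Ax ψ
| pr_gen φ : provable Ax φ -> provable Ax (∀' φ)
| pr_nec φ : provable Ax φ -> provable Ax (□ φ).

Definition consistent (Ax : form -> Prop) : Prop := ~ provable Ax ⊥.

(** Defining conditions of sets are boxed, as in the axioms of eZF: by modal
    extensionality this is what determines a set uniquely. *)

(** [z] is empty; [z = y ∪ {y}]; [z = {x, y}]; [p = (x, y)] (Kuratowski). *)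
Definition is_zero (z : var) : form := □ ∀' ¬ (0 ∈ z.+1).

Definition is_succ (y z : var) : form :=
  □ ∀' (0 ∈ z.+1 ⇔ (0 ∈ y.+1 ∨ 0 ≡ y.+1)).

Definition is_upair (x y z : var) : form :=
  □ ∀' (0 ∈ z.+1 ⇔ (0 ≡ x.+1 ∨ 0 ≡ y.+1)).

Definition is_opair (x y p : var) : form :=
  ∃' ∃' (let s := 1 in let d := 0 in
    is_upair x.+2 x.+2 s ∧ is_upair x.+2 y.+2 d ∧ is_upair s d p.+2).

(** ((a, b), c) ∈ r *)
Definition triple_in (a b c r : var) : form :=
  ∃' ∃' (let p := 1 in let t := 0 in
    is_opair a.+2 b.+2 p ∧ is_opair p c.+2 t ∧ t ∈ r.+2).

Definition inductive_set (u : var) : form :=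
  ex_in u (is_zero 0) ∧ all_in u (ex_in u.+1 (is_succ 1 0)).

Inductive eZF : form -> Prop :=
| ax_extensionality :
    eZF (∀' ∀' (let x := 1 in let y := 0 in
      □ (∀' (0 ∈ x.+1 ⇔ 0 ∈ y.+1)) ⇒ x ≡ y))
| ax_foundation φ :
    eZF ((□ ∀' (□ (all_in 0 (ren (up S) φ)) ⇒ φ)) ⇒ □ ∀' φ)
| ax_pairing :
    eZF (∀' ∀' ∃' is_upair 2 1 0)
| ax_unions :
    eZF (∀' ∃' □ ∀' (let x := 2 in let y := 1 in let z := 0 in
      z ∈ y ⇔ ∃' (0 ∈ x.+1 ∧ z.+1 ∈ 0)))
| ax_comprehension φ : (* φ(z, x): z is 0, x is 1 *)
    eZF (∀' ∃' □ ∀' (let x := 2 in let y := 1 in let z := 0 in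
      z ∈ y ⇔ (z ∈ x ∧ □ ren (up S) φ)))
| ax_power_set :
    eZF (∀' ∃' □ ∀' (let x := 2 in let y := 1 in let z := 0 in
      z ∈ y ⇔ □ ∀' (0 ∈ z.+1 ⇒ 0 ∈ x.+1)))
| ax_infinity :
    eZF (∃' □ inductive_set 0)
| ax_collection u φ : (* φ(y, z): z is 0, y is 1 *)
    eZF (all_in u (∃' □ φ) ⇒
         ∃' (let x := 0 in
             all_in u.+1 (ex_in x.+1 (□ ren (up (up S)) φ)))).

Definition atomic (φ : form) : Prop :=
  exists x y, φ = (x ∈ y) \/ φ = (x ≡ y).

Definition negated_atomic (φ : form) : Prop :=
  exists2 ψ, atomic ψ & φ = (¬ ψ).

Definition stability (Γ : form -> Prop) (σ : form) : Prop :=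
  exists (φ : form) (n : nat),
    [/\ Γ φ, scoped n φ & σ = (□ iter n FAll (φ ⇒ □ φ))].

(** [x] belongs to the least set with the property [C].  For the conditions [C]
    used below, eZF proves that there is a set with the property. *)
Definition in_least (C : var -> form) (x : var) : form :=
  □ ∀' (□ C 0 ⇒ x.+1 ∈ 0).

(** ω is the least set as in the axiom of infinity; comprehension separates it
    from any such set. *)
Definition is_nat (x : var) : form := in_least inductive_set x.

Definition all_nat (φ : form) : form := ∀' (is_nat 0 ⇒ φ).
Definition ex_nat (φ : form) : form := ∃' (is_nat 0 ∧ φ).

(** Cantor's pairing ⟨a, b⟩ = (a + b)(a + b + 1)/2 + a, through its recursion
    ⟨0, 0⟩ = 0, ⟨0, a + 1⟩ = ⟨a, 0⟩ + 1, ⟨a + 1, b⟩ = ⟨a, b + 1⟩ + 1. *)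
Definition pairing_closed (r : var) : form :=
  (∀' (let z := 0 in is_zero z ⇒ triple_in z z z r.+1))
  ∧ (∀' ∀' ∀' ∀' ∀'
      (let z := 4 in let a := 3 in let a' := 2 in let c := 1 in let c' := 0 in
       let r := r.+4.+1 in
       is_zero z ∧ is_succ a a' ∧ is_succ c c' ∧ triple_in a z c r
       ⇒ triple_in z a' c' r))
  ∧ (∀' ∀' ∀' ∀' ∀' ∀'
      (let a := 5 in let a' := 4 in let b := 3 in let b' := 2 in
       let c := 1 in let c' := 0 in let r := r.+4.+2 in
       is_succ a a' ∧ is_succ b b' ∧ is_succ c c' ∧ triple_in a b' c r
       ⇒ triple_in a' b c' r)).

(** c = ⟨a, b⟩ *)
Definition is_cpair (a b c : var) : form :=
  □ ∀' (□ pairing_closed 0 ⇒ triple_in a.+1 b.+1 c.+1 0).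

(** Numerical patterns built with 0, successor and ⟨_, _⟩. *)
Inductive pat : Type :=
| PVar of var
| PZero
| PSucc of pat
| PPair of pat & pat.

Definition pnum (k : nat) : pat := iter k PSucc PZero.

(** [x] is the value of [t], whose variable [i] stands for [r i]. *)
Fixpoint is_value (r : var -> var) (t : pat) (x : var) : form :=
  match t with
  | PVar i => x ≡ r i
  | PZero => is_zero x
  | PSucc t => ∃' (is_value (fun i => (r i).+1) t 0 ∧ is_succ 0 x.+1)
  | PPair t1 t2 =>
      ∃' ∃' (is_value (fun i => (r i).+2) t1 1
             ∧ is_value (fun i => (r i).+2) t2 0 ∧ is_cpair 1 0 x.+2)
  end.

(** Programs are Kleene's indices for the partial recursive functions, from the
    schemes S1-S5 and S9 of his 1959 definition for number arguments, made
    unary by packing arguments with ⟨_, _⟩: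
<<
      {⟨0, c⟩}(x) = c                    {⟨1, 0⟩}(x) = x + 1
      {⟨2, 0⟩}(⟨a, b⟩) = a               {⟨3, 0⟩}(⟨a, b⟩) = b
      {⟨4, ⟨f, g⟩⟩}(x) = ⟨{f}(x), {g}(x)⟩
      {⟨5, ⟨f, g⟩⟩}(x) = {f}({g}(x))
      e = ⟨6, ⟨f, g⟩⟩:  {e}(⟨a, 0⟩) = {f}(a),
                        {e}(⟨a, k + 1⟩) = {g}(⟨a, ⟨k, {e}(⟨a, k⟩)⟩⟩)
      {⟨7, 0⟩}(⟨f, z⟩) = {f}(z)
>>
    Minimization is obtained from the last scheme by the recursion theorem.
    A halting computation {e}(x) = y is coded by ⟨⟨e, ⟨x, y⟩⟩, s⟩, where [s]
    codes the subcomputations. *)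

Definition comp_node (e x y s : pat) : pat := PPair (PPair e (PPair x y)) s.

(** [Rule n ps c]: if the values of all the patterns in [ps] are computations,
    so is the value of [c]; the variables are those [< n]. *)
Record comp_rule := Rule
  { rule_arity : nat; rule_premises : seq pat; rule_conclusion : pat }.

Definition comp_rules : seq comp_rule :=
  let v := PVar in
  [:: let x := v 0 in let c := v 1 in
      Rule 2 [::] (comp_node (PPair (pnum 0) c) x c PZero);
      let x := v 0 in
      Rule 1 [::] (comp_node (PPair (pnum 1) PZero) x (PSucc x) PZero);
      let a := v 0 in let b := v 1 in
      Rule 2 [::] (comp_node (PPair (pnum 2) PZero) (PPair a b) a PZero);
      let a := v 0 in let b := v 1 in
      Rule 2 [::] (comp_node (PPair (pnum 3) PZero) (PPair a b) b PZero);
      let f := v 0 in let g := v 1 in let x := v 2 in let a := v 3 in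
      let b := v 4 in let s := v 5 in let t := v 6 in
      let p := comp_node f x a s in let q := comp_node g x b t in
      Rule 7 [:: p; q]
        (comp_node (PPair (pnum 4) (PPair f g)) x (PPair a b) (PPair p q));
      let f := v 0 in let g := v 1 in let x := v 2 in let z := v 3 in
      let y := v 4 in let s := v 5 in let t := v 6 in
      let p := comp_node g x z s in let q := comp_node f z y t in
      Rule 7 [:: p; q]
        (comp_node (PPair (pnum 5) (PPair f g)) x y (PPair p q));
      let f := v 0 in let g := v 1 in let a := v 2 in let y := v 3 in
      let s := v 4 in
      let p := comp_node f a y s in
      Rule 5 [:: p]
        (comp_node (PPair (pnum 6) (PPair f g)) (PPair a PZero) y p);
      let f := v 0 in let g := v 1 in let a := v 2 in let k := v 3 in
      let z := v 4 in let y := v 5 in let s := v 6 in let t := v 7 in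
      let e := PPair (pnum 6) (PPair f g) in
      let p := comp_node e (PPair a k) z s in
      let q := comp_node g (PPair a (PPair k z)) y t in
      Rule 8 [:: p; q] (comp_node e (PPair a (PSucc k)) y (PPair p q));
      let f := v 0 in let z := v 1 in let y := v 2 in let s := v 3 in
      let p := comp_node f z y s in
      Rule 4 [:: p] (comp_node (PPair (pnum 7) PZero) (PPair f z) y p) ].

Definition conj (s : seq form) : form := foldr FAnd (¬ ⊥) s.

(** The innermost variable [q] is the value of the conclusion. *)
Definition rule_closed (x : var) (R : comp_rule) : form :=
  let: Rule n ps c := R in
  iter n FAll (∀' (let q := 0 in let x := (n + x).+1 in
    conj [seq ∃' (is_value (fun i => i.+2) p 0 ∧ 0 ∈ x.+1) | p <- ps]
    ∧ is_value S c q ⇒ q ∈ x)).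

Definition comp_closed (x : var) : form :=
  conj [seq rule_closed x R | R <- comp_rules].

Definition is_comp (q : var) : form := in_least comp_closed q.

Definition kleene_T (e n q : var) : form :=
  is_comp q
  ∧ ∃' ∃' (let y := PVar 1 in let s := PVar 0 in
      is_value id (comp_node (PVar e.+2) (PVar n.+2) y s) q.+2).

Definition kleene_U (q m : var) : form :=
  ∃' ∃' ∃' (let e := PVar 2 in let x := PVar 1 in let s := PVar 0 in
    is_value id (comp_node e x (PVar m.+3) s) q.+3).

(** φ(n, m) has [m] as variable 0 and [n] as variable 1. *)

Definition ECT_instance (φ : form) : form :=
  (□ all_nat (ex_nat (□ φ)))
  ⇒ ex_nat (□ all_nat (ex_nat (ex_nat
      (let e := 3 in let n := 2 in let m := 1 in let q := 0 in
       let skip_e_q k := match k with 0 => m | 1 => n | k'.+2 => k'.+4 end in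
       kleene_T e n q ∧ kleene_U q m ∧ □ ren skip_e_q φ)))).

Definition ECT (ψ : form) : Prop := exists φ, ψ = ECT_instance φ.

(* Main.v *)
From Stdlib Require List.
From mathcomp Require Import all_boot.
From mathcomp Require Import boolp.
Require Import Defs.

Set Implicit Arguments.
Unset Strict Implicit.
Unset Printing Implicit Defensive.

(** The model is Flagg's realizability interpretation.  The realizers are the
    programs of Kleene's first algebra, and sets are the names of McCarty's
    model, so that membership and equality of names are predicates on programs.
    A modal formula is realized relative to a predicate [D] that plays the role
    of falsity: connectives are translated classically over [D], an atom with
    truth value [a] becomes [(a -> D) -> D], and [□ φ] becomes the double
    negation over [D] of the intersection over all [E] of the values of [φ]
    at [E].  Taking for [E] the value to be realized (Friedman's trick) shows
    that a boxed atom is as good as its intuitionistic truth value; this gives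
    stability of atomics, reduces the axioms of eZF to those of IZF, and
    extracts from [□ ∀n ∃m □ φ] a program computing [m] from [n], which is ECT
    once a program that traces computations is available.  A negated atom, on
    the other hand, does not record whether the truth value of the atom is
    empty, and no program can tell. *)

(** * Computations of programs *)

(* Opaque, so that conversion never evaluates programs in unary notation. *)
Lemma cpair_exists : {p : nat -> nat -> nat |
  [/\ p 0 0 = 0, forall a, p 0 a.+1 = (p a 0).+1
    & forall a b, p a.+1 b = (p a b.+1).+1]}.
Proof.
exists (fun a b => 'C((a + b).+1, 2) + a); split=> // [a|a b].
  by rewrite addn0 add0n addn0 binS bin1 addnS.
by rewrite addSnnS addnS.
Qed.

Definition cpair : nat -> nat -> nat := sval cpair_exists.

Lemma cpair00 : cpair 0 0 = 0.
Proof. by case: (svalP cpair_exists). Qed.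

Lemma cpair0S a : cpair 0 a.+1 = (cpair a 0).+1.
Proof. by case: (svalP cpair_exists). Qed.

Lemma cpairS a b : cpair a.+1 b = (cpair a b.+1).+1.
Proof. by case: (svalP cpair_exists). Qed.

(** The step to the next pair along the antidiagonals. Its iterates from [(0, 0)] list the pairs in
    the order of their codes, which inverts the pairing without arithmetic. *)
Definition cnext (p : nat * nat) : nat * nat :=
  if p.2 is b.+1 then (p.1.+1, b) else (0, p.1.+1).

Definition cunpair (n : nat) : nat * nat := iter n cnext (0, 0).
Definition cfst n := (cunpair n).1.
Definition csnd n := (cunpair n).2.

Lemma cunpairK n : cpair (cfst n) (csnd n) = n.
Proof.
elim: n => [|n IH]; first exact: cpair00.
rewrite /cfst /csnd /cunpair iterS -/(cunpair n).
move: IH; rewrite /cfst /csnd; case: (cunpair n) => a [|b] /= <-.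
  by rewrite cpair0S.
by rewrite cpairS.
Qed.

(** Induction on the antidiagonal [a + b], then on [a]: a step back either lowers [a] on the same
    antidiagonal or leaves it for the previous one. *)
Lemma cpairK a b : cunpair (cpair a b) = (a, b).
Proof.
suff H n : forall a b, a + b = n -> cunpair (cpair a b) = (a, b) by exact: H.
elim: n => [|n IHn] {}a {}b; first by case: a b => [|//] [|//] _; rewrite cpair00.
elim: a b => [|a IHa] b ab; last first.
  rewrite cpairS /cunpair iterS -/(cunpair _) IHa //.
  by rewrite addnS -addSn.
case: b ab => // b [bn]; rewrite cpair0S /cunpair iterS -/(cunpair _) IHn //.
by rewrite addn0.
Qed.

Lemma cpair1 a b : cfst (cpair a b) = a. Proof. by rewrite /cfst cpairK. Qed.
Lemma cpair2 a b : csnd (cpair a b) = b. Proof. by rewrite /csnd cpairK. Qed.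

Lemma cpair_inj a b a' b' : cpair a b = cpair a' b' -> a = a' /\ b = b'.
Proof. by move=> /(congr1 cunpair); rewrite !cpairK => -[]. Qed.

(** The height [h] of a computation makes the tracer below a recursion on a
    natural number. *)
Inductive compn : nat -> nat -> nat -> nat -> Prop :=
| c_const h c x : compn h (cpair 0 c) x c
| c_succ h x : compn h (cpair 1 0) x x.+1
| c_fst h a b : compn h (cpair 2 0) (cpair a b) a
| c_snd h a b : compn h (cpair 3 0) (cpair a b) b
| c_pair h f g x a b : compn h f x a -> compn h g x b ->
    compn h.+1 (cpair 4 (cpair f g)) x (cpair a b)
| c_comp h f g x z y : compn h g x z -> compn h f z y ->
    compn h.+1 (cpair 5 (cpair f g)) x y
| c_rec0 h f g a y : compn h f a y ->
    compn h.+1 (cpair 6 (cpair f g)) (cpair a 0) y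
| c_recS h f g a k z y :
    compn h (cpair 6 (cpair f g)) (cpair a k) z ->
    compn h g (cpair a (cpair k z)) y ->
    compn h.+1 (cpair 6 (cpair f g)) (cpair a k.+1) y
| c_univ h f z y : compn h f z y -> compn h.+1 (cpair 7 0) (cpair f z) y.

Lemma compnW h k e x y : h <= k -> compn h e x y -> compn k e x y.
Proof.
move=> hk H; elim: H k hk => {h e x y}.
- by move=> *; exact: c_const.
- by move=> *; exact: c_succ.
- by move=> *; exact: c_fst.
- by move=> *; exact: c_snd.
- by move=> h f g x a b _ H1 _ H2 [//|k] hk; apply: c_pair; [exact: H1|exact: H2].
- move=> h f g x z y _ H1 _ H2 [//|k] hk.
  by apply: (c_comp (z := z)); [exact: H1|exact: H2].
- by move=> h f g a y _ H1 [//|k] hk; apply: c_rec0; exact: H1.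
- move=> h f g a m z y _ H1 _ H2 [//|k] hk.
  by apply: (c_recS (z := z)); [exact: H1|exact: H2].
- by move=> h f z y _ H1 [//|k] hk; apply: c_univ; exact: H1.
Qed.

Definition comp (e x y : nat) : Prop := exists h, compn h e x y.

Lemma comp_join e x y e' x' y' : comp e x y -> comp e' x' y' ->
  exists h, compn h e x y /\ compn h e' x' y'.
Proof.
move=> [h H] [k K]; exists (maxn h k).
by split; [apply: compnW H; rewrite leq_maxl|apply: compnW K; rewrite leq_maxr].
Qed.

(** Inversion of a computation leaves equations between codes; injectivity of the pairing refutes
    those with distinct scheme tags. *)
Ltac cpair_split := repeat match goal with
  | E : cpair _ _ = cpair _ _ |- _ =>
      let E1 := fresh in let E2 := fresh in
      case: (cpair_inj E) => E1 E2; clear E;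
      try discriminate E1; try (injection E2; clear E2; intros); subst
  end; try discriminate.

Lemma compn_fun h e x y : compn h e x y -> forall k y', compn k e x y' -> y = y'.
Proof.
elim=> {h e x y}.
all: intros; match goal with H : compn ?k (cpair _ _) _ ?y |- _ = ?y =>
       inversion H; clear H end; cpair_split => //.
- by congr cpair; eauto.
all: repeat match goal with
  | IH : (forall k y', compn k ?e ?x y' -> ?z = y'), H : compn _ ?e ?x ?z' |- _ =>
      have ? := IH _ _ H; clear IH; subst end => //.
Qed.

Lemma comp_fun e x y y' : comp e x y -> comp e x y' -> y = y'.
Proof. by move=> [h H] [k K]; exact: (compn_fun H K). Qed.

(** * Realizability of predicates *)

Definition cConst n := cpair 0 n.
Definition cSucc := cpair 1 0.
Definition cFst := cpair 2 0.
Definition cSnd := cpair 3 0.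
Definition cPair f g := cpair 4 (cpair f g).
Definition cComp f g := cpair 5 (cpair f g).
Definition cRec f g := cpair 6 (cpair f g).
Definition cUniv := cpair 7 0.
(** This is the identity because every number is a pair. *)
Definition cId := cPair cFst cSnd.
Definition cApp f g := cComp cUniv (cPair f g).

Lemma comp_const n x : comp (cConst n) x n.
Proof. by exists 0; exact: c_const. Qed.
Lemma comp_succ x : comp cSucc x x.+1.
Proof. by exists 0; exact: c_succ. Qed.
Lemma comp_fst x : comp cFst x (cfst x).
Proof. by exists 0; rewrite -[x in compn _ _ x]cunpairK; exact: c_fst. Qed.
Lemma comp_snd x : comp cSnd x (csnd x).
Proof. by exists 0; rewrite -[x in compn _ _ x]cunpairK; exact: c_snd. Qed.
Lemma comp_pair f g x a b : comp f x a -> comp g x b ->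
  comp (cPair f g) x (cpair a b).
Proof. by move=> F G; have [h []] := comp_join F G; exists h.+1; exact: c_pair. Qed.
Lemma comp_comp f g x z y : comp g x z -> comp f z y -> comp (cComp f g) x y.
Proof.
by move=> G F; have [h []] := comp_join G F; exists h.+1; exact: (c_comp (z := z)).
Qed.
Lemma comp_univ f z y : comp f z y -> comp cUniv (cpair f z) y.
Proof. by move=> [h H]; exists h.+1; exact: c_univ. Qed.
Lemma comp_rec0 f g a y : comp f a y -> comp (cRec f g) (cpair a 0) y.
Proof. by move=> [h H]; exists h.+1; exact: c_rec0. Qed.
Lemma comp_recS f g a k z y :
  comp (cRec f g) (cpair a k) z -> comp g (cpair a (cpair k z)) y ->
  comp (cRec f g) (cpair a k.+1) y.
Proof.
by move=> F G; have [h []] := comp_join F G; exists h.+1; exact: (c_recS (z := z)).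
Qed.
Lemma comp_id x : comp cId x x.
Proof.
by rewrite -[x in comp _ _ x]cunpairK; apply: comp_pair; [exact: comp_fst|exact: comp_snd].
Qed.
Lemma comp_app f g x u v y : comp f x u -> comp g x v -> comp u v y ->
  comp (cApp f g) x y.
Proof.
by move=> F G U; apply: (comp_comp (comp_pair F G)); exact: comp_univ.
Qed.

Definition smn c r := cComp c (cPair (cConst r) cId).
(** The s-m-n theorem: this program assembles the code [smn c r] from [r], the constants 5, 4 and 0
    being the tags of composition, pairing and constants. *)
Definition cLam c :=
  cPair (cConst 5) (cPair (cConst c)
    (cPair (cConst 4) (cPair (cPair (cConst 0) cId) (cConst cId)))).

Lemma comp_smn c r a y : comp c (cpair r a) y -> comp (smn c r) a y.
Proof.
by apply: comp_comp; apply: comp_pair; [exact: comp_const|exact: comp_id].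
Qed.

Lemma comp_lam c r : comp (cLam c) r (smn c r).
Proof.
by do ![exact: comp_const | exact: comp_id | apply: comp_pair].
Qed.

(* A predicate stands for a proposition, its members being the realizers. *)
Definition pr := nat -> Prop.
Declare Scope pr_scope.
Delimit Scope pr_scope with pr.
Bind Scope pr_scope with pr.
Local Open Scope pr_scope.

Definition imp (A B : pr) : pr := fun e => forall a, A a -> exists2 b, comp e a b & B b.
Definition prd (A B : pr) : pr := fun n => A (cfst n) /\ B (csnd n).
Definition pall (X : Type) (F : X -> pr) : pr := fun n => forall x, F x n.
Definition pex (X : Type) (F : X -> pr) : pr := fun n => exists x, F x n.
Definition num (n : nat) : pr := fun m => m = n.
Definition tt : pr := fun _ => True.

Notation "A ~> B" := (imp A B) (at level 55, right associativity) : pr_scope.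
Notation "A ** B" := (prd A B) (at level 52, left associativity) : pr_scope.

(* The code [c] is uniform in every parameter of [G] and [A]: the rules below
   are those of natural deduction, and applying them with an existential
   variable for [c] extracts the code from the derivation, while the scope of
   the variable enforces the uniformity. *)
Definition ent (G : pr) (c : nat) (A : pr) : Prop := (G ~> A) c.

Lemma r_lem A B c G d : ent A c B -> ent G d A -> ent G (cComp c d) B.
Proof.
move=> H K r /K[a ra /H[b ab Bb]]; exists b => //; exact: comp_comp ra ab.
Qed.

Lemma r_const A n G : A n -> ent G (cConst n) A.
Proof. by move=> An r _; exists n => //; exact: comp_const. Qed.

Lemma r_id A : ent A cId A.
Proof. by move=> r Ar; exists r => //; exact: comp_id. Qed.

Lemma r_var G A : ent (G ** A) cSnd A.
Proof. by move=> r [_ Ar]; exists (csnd r) => //; exact: comp_snd. Qed.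

Lemma r_drop G A : ent (G ** A) cFst G.
Proof. by move=> r [Gr _]; exists (cfst r) => //; exact: comp_fst. Qed.

Lemma r_wk G A B c : ent G c B -> ent (G ** A) (cComp c cFst) B.
Proof. by move=> H; exact: r_lem H (@r_drop _ _). Qed.

Lemma r_pair G A B c d : ent G c A -> ent G d B -> ent G (cPair c d) (A ** B).
Proof.
move=> H K r Gr; have [a ra Aa] := H _ Gr; have [b rb Bb] := K _ Gr.
exists (cpair a b); first exact: comp_pair.
by rewrite /prd cpair1 cpair2.
Qed.

Lemma r_fst G A B c : ent G c (A ** B) -> ent G (cComp cFst c) A.
Proof. exact: r_lem (@r_drop _ _). Qed.

Lemma r_snd G A B c : ent G c (A ** B) -> ent G (cComp cSnd c) B.
Proof. exact: r_lem (@r_var _ _). Qed.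

Lemma r_lam G A B c : ent (G ** A) c B -> ent G (cLam c) (A ~> B).
Proof.
move=> H r Gr; exists (smn c r); first exact: comp_lam.
move=> a Aa; have [|b cb Bb] := H (cpair r a); first by rewrite /prd cpair1 cpair2.
by exists b => //; exact: comp_smn.
Qed.

(** The closure exists before any [x] is considered, so [X] may be empty here, in contrast to
    [r_allI]. *)
Lemma r_lamA G X (A B : X -> pr) c : (forall x, ent (G ** A x) c (B x)) ->
  ent G (cLam c) (pall (fun x => A x ~> B x)).
Proof.
move=> H r Gr; exists (smn c r) => [|x]; first exact: comp_lam.
have [b cb Hb] := r_lam (H x) Gr.
by rewrite (comp_fun (comp_lam _ _) cb).
Qed.

Lemma r_app G A B c d : ent G c (A ~> B) -> ent G d A -> ent G (cApp c d) B.
Proof.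
move=> H K r Gr; have [a ra Aa] := K _ Gr; have [f rf /(_ a Aa)[b fb Bb]] := H _ Gr.
by exists b => //; exact: comp_app rf ra fb.
Qed.

Lemma r_cut G A B c d : ent G c A -> ent (G ** A) d B ->
  ent G (cComp d (cPair cId c)) B.
Proof. by move=> H K; apply: r_lem K _; exact: r_pair (@r_id _) H. Qed.

(** The inhabitant [x0] guarantees that [c] halts; determinism then makes its output the same for
    all [x]. *)
Lemma r_allI G X (F : X -> pr) c (x0 : X) :
  (forall x, ent G c (F x)) -> ent G c (pall F).
Proof.
move=> H r Gr; have [a ra _] := H x0 _ Gr; exists a => // x.
by have [b rb Fb] := H x _ Gr; rewrite (comp_fun ra rb).
Qed.

Lemma r_allE G X (F : X -> pr) c x : ent G c (pall F) -> ent G c (F x).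
Proof. by move=> H r /H[a ra Fa]; exists a. Qed.

Lemma r_exI G X (F : X -> pr) c x : ent G c (F x) -> ent G c (pex F).
Proof. by move=> H r /H[a ra Fa]; exists a => //; exists x. Qed.

Lemma r_exL G X (F : X -> pr) A c :
  (forall x, ent (G ** F x) c A) -> ent (G ** pex F) c A.
Proof. by move=> H r [Gr [x Fr]]; apply: (H x); split. Qed.

Definition cAssoc := cPair (cPair cFst (cComp cFst cSnd)) (cComp cSnd cSnd).

Lemma r_prdL G A B C c : ent (G ** A ** B) c C -> ent (G ** (A ** B)) (cComp c cAssoc) C.
Proof.
move=> H; apply: r_lem H _; apply: r_pair; first apply: r_pair.
- exact: r_drop.
- exact: r_fst (@r_var _ _).
- exact: r_snd (@r_var _ _).
Qed.

(** Lets the argument depend on the particular realizer [g], while the code [c] stays the same for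
    all of them. *)
Lemma r_reify G A B c :
  (forall g, A g -> ent (G ** num g) c B) -> ent (G ** A) c B.
Proof. by move=> H r [Gr Ar]; apply: (H _ Ar); split. Qed.

Lemma r_rec G (P : nat -> pr) c d n e :
  ent G c (P 0) -> (forall k, ent (G ** (num k ** P k)) d (P k.+1)) ->
  ent G e (num n) -> ent G (cComp (cRec c d) (cPair cId e)) (P n).
Proof.
move=> H0 HS He r Gr; have [m re Em] := He _ Gr; rewrite {}Em in re.
suff [b rb Pb] : exists2 b, comp (cRec c d) (cpair r n) b & P n b.
  by exists b => //; apply: comp_comp rb; apply: comp_pair re; exact: comp_id.
elim: n {He re} => [|k [b rb Pb]].
  by have [b rb Pb] := H0 _ Gr; exists b => //; exact: comp_rec0.
have [|b' rb' Pb'] := HS k (cpair r (cpair k b)).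
  by rewrite /prd !cpair1 !cpair2 !cpair1.
by exists b' => //; exact: comp_recS rb rb'.
Qed.

Lemma r_0 G : ent G (cConst 0) (num 0).
Proof. exact: r_const. Qed.

Lemma r_S G n c : ent G c (num n) -> ent G (cComp cSucc c) (num n.+1).
Proof.
by apply: r_lem => m ->; exists n.+1 => //; exact: comp_succ.
Qed.

Lemma r_cpair G a b c d : ent G c (num a) -> ent G d (num b) ->
  ent G (cPair c d) (num (cpair a b)).
Proof.
move=> H K r Gr; have [m ra Em] := H _ Gr; have [k rb Ek] := K _ Gr.
rewrite {}Em in ra; rewrite {}Ek in rb.
by exists (cpair a b) => //; exact: comp_pair.
Qed.

Lemma r_cfst G n c : ent G c (num n) -> ent G (cComp cFst c) (num (cfst n)).
Proof. by apply: r_lem => m ->; exists (cfst n) => //; exact: comp_fst. Qed.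

Lemma r_csnd G n c : ent G c (num n) -> ent G (cComp cSnd c) (num (csnd n)).
Proof. by apply: r_lem => m ->; exists (csnd n) => //; exact: comp_snd. Qed.

(* The fixpoint of [c] in the environment [r] is [smn w (cpair r w)], where
   [w = cFixBody c] passes itself on through [r]. *)
Definition cFixBody c :=
  let r := cComp cFst cFst in let w := cComp cSnd cFst in
  let self := cPair (cConst 5) (cPair w
    (cPair (cConst 4) (cPair (cPair (cConst 0) cFst) (cConst cId)))) in
  cApp (cComp c (cPair r self)) cSnd.
Definition cFix c := cComp (cLam (cFixBody c)) (cPair cId (cConst (cFixBody c))).

(** Kleene's recursion theorem supplies the self-reference, and well-founded induction shows that it
    realizes. The proof of [lt (m y) (m x)] is quantified by an intersection, so the program never
    sees the measure. *)
Lemma r_fix X Y (m : X -> Y) (lt : Y -> Y -> Prop) (A B : X -> pr) G c :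
  well_founded lt ->
  (forall x, ent (G ** pall (fun y => pall (fun _ : lt (m y) (m x) => A y ~> B y)))
    c (A x ~> B x)) ->
  forall x, ent G (cFix c) (A x ~> B x).
Proof.
move=> wf H x r Gr; set w := cFixBody c; set s := smn w (cpair r w).
exists s.
  apply: (comp_comp (z := cpair r w)); last exact: comp_lam.
  by apply: comp_pair; [exact: comp_id|exact: comp_const].
move mx: (m x) => u; elim/(well_founded_ind wf): u => u IH in x mx *.
move=> a Ax.
have [|f cf /(_ a Ax)[b fb Bb]] := H x (cpair r s).
  by split; rewrite (cpair1, cpair2) // => y lyx; apply: IH (erefl _) => //; rewrite -mx.
exists b => //; apply: comp_smn.
apply: comp_app fb; last by rewrite -{2}(cpair2 (cpair r w) a); exact: comp_snd.
apply: comp_comp cf.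
have Fst p q : comp cFst (cpair p q) p.
  by rewrite -{2}(cpair1 p q); exact: comp_fst.
have Snd p q : comp cSnd (cpair p q) q.
  by rewrite -{2}(cpair2 p q); exact: comp_snd.
apply: comp_pair; first exact: comp_comp (Fst _ _) (Fst _ _).
apply: comp_pair; first exact: comp_const.
apply: comp_pair; first exact: comp_comp (Fst _ _) (Snd _ _).
apply: comp_pair; first exact: comp_const.
apply: comp_pair; last exact: comp_const.
by apply: comp_pair (Fst _ _); exact: comp_const.
Qed.

Lemma r_eq G A B c : ent G c A -> A = B -> ent G c B.
Proof. by move=> H <-. Qed.

Definition r_allP G (F : pr -> pr) c := @r_allI G pr F c tt.

(* Hypotheses are numbered from the right, starting with 0. *)
Ltac hyp n := idtac; lazymatch n with
  | 0 => first [eapply r_var | eapply r_id]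
  | S ?m => eapply r_wk; hyp m
  end.

Ltac triv := exact: (@r_const tt 0).
Ltac inst_by x tac :=
  eapply r_eq; [eapply (@r_allE _ _ _ _ x); tac|reflexivity].
Ltac inst1 n x :=
  eapply r_eq; [eapply (@r_allE _ _ _ _ x); hyp n|reflexivity].
Ltac inst2 n x y :=
  eapply r_eq; [eapply (@r_allE _ _ _ _ y); inst1 n x|reflexivity].

Ltac lem H := eapply r_lem; [eapply (proj2_sig H)|].
Ltac cut_by tac := eapply r_cut; [tac|].

Lemma r_num (A : pr) n : A n -> ent (num n) cId A.
Proof. by move=> An _ ->; exists n => //; exact: comp_id. Qed.

Lemma r_case c d e : {f | forall G A n, (n = 0 -> ent G c A) ->
  (forall m, n = m.+1 -> ent (G ** num m) d A) -> ent G e (num n) -> ent G f A}.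
Proof.
eexists => G A n H0 HS He.
eapply r_app; last triv.
eapply r_eq; [eapply (@r_allE _ _ (fun _ : n = n => tt ~> A) _ erefl)|reflexivity].
eapply (@r_rec G (fun k => pall (fun _ : k = n => tt ~> A))); last exact: He.
  eapply (@r_lamA _ _ (fun=> tt) (fun=> A)) => n0.
  by eapply r_lem; [exact: (H0 (esym n0))|eapply r_wk; exact: r_id].
move=> k; eapply r_prdL; eapply (@r_lamA _ _ (fun=> tt) (fun=> A)) => nS.
eapply r_lem; first exact: (HS _ (esym nS)).
by eapply r_pair; [do 3 eapply r_wk; exact: r_id|hyp 2].
Qed.

(** * Double negation relative to an answer type [D] *)

Definition nn (D A : pr) : pr := (A ~> D) ~> D.

Lemma n_ret G D A c : ent G c A -> ent G (cLam (cApp cSnd (cComp c cFst))) (nn D A).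
Proof. by move=> H; apply: r_lam; eapply r_app; [hyp 0|eapply r_wk; exact: H]. Qed.

Lemma n_elim G D A c d : ent G c (nn D A) -> ent (G ** A) d D ->
  ent G (cApp c (cLam d)) D.
Proof. by move=> H K; apply: (@r_app G (A ~> D) D c) => //; exact: r_lam. Qed.

(** Friedman's trick: when the answer type is [A] itself, the identity serves as refutation of
    [A]. *)
Lemma n_run G A c : ent G c (nn A A) -> ent G (cApp c (cLam cSnd)) A.
Proof. by move=> H; apply: n_elim H _; exact: r_var. Qed.

Definition cBind c d :=
  cLam (cApp (cComp c cFst) (cLam (cApp (cComp d
    (cPair (cComp cFst cFst) cSnd)) (cComp cSnd cFst)))).

Lemma n_bind G D A B c d : ent G c (nn D A) -> ent (G ** A) d (nn D B) ->
  ent G (cBind c d) (nn D B).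
Proof.
move=> H K; apply: r_lam; eapply n_elim; first by eapply r_wk; exact: H.
eapply r_app; last by hyp 1.
by apply: r_lem K _; apply: r_pair; [exact: r_wk (@r_drop _ _)|exact: r_var].
Qed.

Definition orr (D A B : pr) : pr := ((A ~> D) ** (B ~> D)) ~> D.

Lemma r_orI1 c : {d | forall G D A B, ent G c A -> ent G d (orr D A B)}.
Proof.
eexists => G D A B H; eapply r_lam; eapply r_app; first by eapply r_fst; hyp 0.
by eapply r_wk; exact: H.
Qed.

Lemma r_orI2 c : {d | forall G D A B, ent G c B -> ent G d (orr D A B)}.
Proof.
eexists => G D A B H; eapply r_lam; eapply r_app; first by eapply r_snd; hyp 0.
by eapply r_wk; exact: H.
Qed.

Lemma r_orE c d e : {f | forall G D A B C, ent G c (orr D A B) ->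
  ent (G ** A) d (nn D C) -> ent (G ** B) e (nn D C) -> ent G f (nn D C)}.
Proof.
eexists => G D A B C H HA HB; eapply r_lam; eapply r_app.
  by eapply r_wk; exact: H.
eapply r_pair; eapply r_lam; (eapply r_app; last by hyp 1).
  eapply r_lem; first exact: HA.
  by eapply r_pair; [do 2 eapply r_wk; exact: r_id|hyp 0].
eapply r_lem; first exact: HB.
by eapply r_pair; [do 2 eapply r_wk; exact: r_id|hyp 0].
Qed.

(** * Names of sets *)

(* The names of McCarty's realizability model of IZF. *)
Inductive name : Type := sup (I : Type) (el : I -> name) (rl : I -> pr).

Definition idx x : Type := match x with @sup J _ _ => J end.
Definition el x : idx x -> name := 
  match x with sup _ f _ => f end.
Definition rl x : idx x -> pr := 
  match x with sup _ _ R => R end.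

(** The second conjunct also keeps the element of [x] on the left, which makes the recursion
    structural in [x] alone; symmetry is then a lemma. *)
Fixpoint eqv (x y : name) : pr :=
  let: @sup J f R := x in
  pall (fun i : J => R i ~> pex (fun j => rl j ** eqv (f i) (@el y j))) **
  pall (fun j => @rl y j ~> pex (fun i : J => R i ** eqv (f i) (el j))).

Definition mem (x y : name) : pr := pex (fun j => @rl y j ** eqv x (el j)).

Lemma eqvE x y : eqv x y =
  pall (fun i => @rl x i ~> mem (el i) y) **
  pall (fun j => @rl y j ~> pex (fun i => @rl x i ** eqv (el i) (el j))).
Proof. by case: x. Qed.

Definition child (y x : name) : Prop := exists i : idx x, y = el i.

Lemma child_wf : well_founded child.
Proof. by elim=> J f R IH; constructor=> y [i ->]. Qed.

Definition empty : name := sup (fun v : void => match v with end) (fun=> tt).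
Definition r_allN G (F : name -> pr) c := @r_allI G name F c empty.

Lemma child_el x (i : idx x) : child (el i) x.
Proof. by exists i. Qed.

Lemma eqv_refl : {c | forall G x, ent G c (eqv x x)}.
Proof.
(* [r_fix] produces functions only, hence the dummy argument. *)
pose P x := tt ~> eqv x x.
suff [c H] : {c | forall G x, ent G c (P x)}.
  exists (cApp c (cConst 0)) => G x; apply: r_app (H _ _) _; exact: r_const.
eexists => G; eapply (@r_fix _ _ id _ _ (fun x => eqv x x) _ _ child_wf) => x.
eapply r_lam; rewrite eqvE; eapply r_pair.
- eapply r_lamA => i; eapply (@r_exI _ _ _ _ i); eapply r_pair; first hyp 0.
  eapply r_app; last triv.
  inst2 2 (el i) (child_el i).
- eapply r_lamA => i; eapply (@r_exI _ _ _ _ i); eapply r_pair; first hyp 0.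
  eapply r_app; last triv.
  inst2 2 (el i) (child_el i).
Qed.

Lemma eqv_sym : {c | forall x y, ent (eqv x y) c (eqv y x)}.
Proof.
suff [c H] : {c | forall p, ent tt c (eqv p.1 p.2 ~> eqv p.2 p.1)}.
  eexists => x y; eapply r_app; last exact: r_id.
  by eapply r_lem; [exact: (H (x, y))|triv].
eexists; eapply (@r_fix _ _ fst _ (fun p => eqv p.1 p.2) (fun p => eqv p.2 p.1) _ _ child_wf) => p.
eapply r_lam; rewrite [eqv p.1 p.2]eqvE [eqv p.2 p.1]eqvE.
eapply r_prdL; eapply r_pair.
- eapply r_lamA => j; cut_by ltac:(eapply r_app; [inst1 1 j|hyp 0]).
  eapply r_exL => i; eapply r_prdL.
  eapply (@r_exI _ _ _ _ i); eapply r_pair; first hyp 1.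
  eapply r_app; [inst2 5 (el i, el j) (child_el i)|hyp 0].
- eapply r_lamA => i; cut_by ltac:(eapply r_app; [inst1 2 i|hyp 0]).
  eapply r_exL => j; eapply r_prdL.
  eapply (@r_exI _ _ _ _ j); eapply r_pair; first hyp 1.
  eapply r_app; [inst2 5 (el i, el j) (child_el i)|hyp 0].
Qed.

Lemma eqv_trans : {c | forall x y z, ent (eqv x y ** eqv y z) c (eqv x z)}.
Proof.
suff [c H] : {c | forall p, ent tt c (eqv p.1 p.2.1 ** eqv p.2.1 p.2.2 ~> eqv p.1 p.2.2)}.
  eexists => x y z; eapply r_app; last exact: r_id.
  by eapply r_lem; [exact: (H (x, (y, z)))|triv].
eexists; eapply (@r_fix _ _ fst _ (fun p => eqv p.1 p.2.1 ** eqv p.2.1 p.2.2)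
  (fun p => eqv p.1 p.2.2) _ _ child_wf) => -[x [y z]] /=.
eapply r_lam; rewrite [eqv x y]eqvE [eqv y z]eqvE [eqv x z]eqvE.
eapply r_prdL; eapply r_prdL.
cut_by ltac:(eapply r_fst; hyp 2); cut_by ltac:(eapply r_snd; hyp 3); eapply r_pair.

- eapply r_lamA => i; cut_by ltac:(eapply r_app; [inst1 2 i|hyp 0]).
  eapply r_exL => j; eapply r_prdL; cut_by ltac:(eapply r_app; [inst1 6 j|hyp 1]).
  eapply r_exL => k; eapply r_prdL; eapply (@r_exI _ _ _ _ k); eapply r_pair.
    hyp 1.
  eapply r_app; [inst2 10 (el i, (el j, el k)) (child_el i)|].
  by eapply r_pair; [hyp 2|hyp 0].
- eapply r_lamA => k; cut_by ltac:(eapply r_app; [inst1 3 k|hyp 0]).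
  eapply r_exL => j; eapply r_prdL; cut_by ltac:(eapply r_app; [inst1 3 j|hyp 1]).
  eapply r_exL => i; eapply r_prdL; eapply (@r_exI _ _ _ _ i); eapply r_pair.
    hyp 1.
  eapply r_app; [inst2 10 (el i, (el j, el k)) (child_el i)|].
  by eapply r_pair; [hyp 0|hyp 2].
Qed.

Lemma mem_eqvl : {c | forall x y z, ent (eqv x y ** mem y z) c (mem x z)}.
Proof.
eexists => x y z; eapply r_exL => k; eapply r_prdL.
eapply (@r_exI _ _ _ _ k); eapply r_pair; first hyp 1.
lem eqv_trans; eapply r_pair; [hyp 2|hyp 0].
Qed.

Definition sub (x y : name) : pr := pall (fun z => mem z x ~> mem z y).

Lemma eqv_sub : {c | forall x y, ent (eqv x y) c (sub x y)}.
Proof.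
eexists => x y; rewrite eqvE; eapply r_lamA => z.
eapply r_exL => i; eapply r_prdL.
lem mem_eqvl; eapply r_pair; first hyp 0.
eapply r_app; last by hyp 1.
eapply r_eq; [eapply (@r_allE _ _ _ _ i); eapply r_fst; hyp 2|reflexivity].
Qed.

Lemma mem_el : {c | forall x (i : idx x), ent (rl i) c (mem (el i) x)}.
Proof.
eexists => x i; eapply (@r_exI _ _ _ _ i); eapply r_pair; first exact: r_id.
exact: (svalP eqv_refl).
Qed.

Lemma sub_eqv : {c | forall x y, ent (sub x y ** sub y x) c (eqv x y)}.
Proof.
eexists => x y; rewrite eqvE; eapply r_pair; eapply r_lamA => i.
  eapply r_app; first by inst_by (el i) ltac:(eapply r_fst; hyp 1).
  by lem mem_el; hyp 0.
cut_by ltac:(eapply r_app; [inst_by (el i) ltac:(eapply r_snd; hyp 1)|]).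
  by lem mem_el; hyp 0.
eapply r_exL => j; eapply r_prdL.
eapply (@r_exI _ _ _ _ j); eapply r_pair; first hyp 1.
lem eqv_sym; hyp 0.
Qed.

Lemma mem_eqv : {c | forall x x' y y',
  ent (eqv x x' ** eqv y y' ** mem x y) c (mem x' y')}.
Proof.
eexists => x x' y y'; lem mem_eqvl; eapply r_pair; first by lem eqv_sym; hyp 2.
eapply r_app; last by hyp 0.
by inst_by x ltac:(lem eqv_sub; hyp 1).
Qed.

Lemma eqv_eqv : {c | forall x x' y y',
  ent (eqv x x' ** eqv y y' ** eqv x y) c (eqv x' y')}.
Proof.
eexists => x x' y y'; lem eqv_trans; eapply r_pair; first by lem eqv_sym; hyp 2.
by lem eqv_trans; eapply r_pair; [hyp 0|hyp 1].
Qed.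

(** * Realizability of modal formulas *)

Definition env := var -> name.
Definition scons (x : name) (r : env) : env := fun k => if k is k'.+1 then r k' else x.
Notation "x .: r" := (scons x r) (at level 60, right associativity).

(* Classical logic by double negation, falsity being an arbitrary predicate [D];
   the box quantifies over all [D], and so makes the truth value of a formula
   intuitionistic. *)
Fixpoint sat (f : form) (r : env) (D : pr) : pr :=
  match f with
  | FMem x y => nn D (mem (r x) (r y))
  | FEq x y => nn D (eqv (r x) (r y))
  | FBot => D
  | FAnd f g => sat f r D ** sat g r D
  | FOr f g => ((sat f r D ~> D) ** (sat g r D ~> D)) ~> D
  | FImp f g => sat f r D ~> sat g r D
  | FAll f => pall (fun x => sat f (x .: r) D)
  | FEx f => nn D (pex (fun x => sat f (x .: r) D))
  | FBox f => nn D (pall (sat f r))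
  end.

Definition bx f r : pr := pall (sat f r).

Lemma nn_neg : {c | forall D A, ent (nn D (A ~> D)) c (A ~> D)}.
Proof.
eexists => D A; eapply r_lam; eapply n_elim; first by hyp 1.
eapply r_app; [hyp 0|hyp 1].
Qed.

(** Each clause of [sat] is [D] itself, a predicate of the form [A ~> D], or arises from stable ones
    by conjunction, implication into a stable one or intersection; all these forms are stable under
    double negation. *)
Lemma dne f : {c | forall r D, ent (nn D (sat f r D)) c (sat f r D)}.
Proof.
elim: f => /= [x y|x y||f IHf g IHg|f IHf g IHg|f IHf g IHg|f IHf|f IHf|f IHf].
- by exists (sval nn_neg) => r D; exact: (svalP nn_neg).
- by exists (sval nn_neg) => r D; exact: (svalP nn_neg).
- by eexists => _ D; eapply n_run; exact: r_id.
- eexists => r D; eapply r_pair; [lem IHf|lem IHg]; (eapply n_bind; first hyp 0);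
    eapply n_ret; [eapply r_fst|eapply r_snd]; hyp 0.
- by exists (sval nn_neg) => r D; exact: (svalP nn_neg).
- eexists => r D; eapply r_lam; lem IHg; eapply n_bind; first by hyp 1.
  by eapply n_ret; eapply r_app; [hyp 0|hyp 1].
- eexists => r D; eapply r_allN => x; lem IHf; eapply n_bind; first by hyp 0.
  by eapply n_ret; inst1 0 x.
- by exists (sval nn_neg) => r D; exact: (svalP nn_neg).
- by exists (sval nn_neg) => r D; exact: (svalP nn_neg).
Qed.

Lemma s_bind f r D G A c d : ent G c (nn D A) -> ent (G ** A) d (sat f r D) ->
  ent G (cComp (sval (dne f)) (cBind c (cLam (cApp cSnd (cComp d cFst))))) (sat f r D).
Proof.
by move=> H K; lem (dne f); apply: n_bind H _; exact: n_ret.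
Qed.

Lemma s_exfalso f r D G c : ent G c D ->
  ent G (cComp (sval (dne f)) (cLam (cComp c cFst))) (sat f r D).
Proof. by move=> H; lem (dne f); eapply r_lam; eapply r_wk. Qed.

Lemma scons_up x r s : (x .: s) \o up r = x .: (s \o r).
Proof. by apply/funext; case. Qed.

Lemma sat_ren f r s : sat (ren r f) s = sat f (s \o r).
Proof.
elim: f r s => //=
  [f IHf g IHg|f IHf g IHg|f IHf g IHg|f IHf|f IHf|f IHf] r s;
  apply/funext => D; rewrite ?IHf ?IHg //.
- by congr pall; apply/funext => x; rewrite IHf scons_up.
- by congr nn; congr pex; apply/funext => x; rewrite IHf scons_up.
Qed.

Lemma sat_inst y f r : sat (inst y f) r = sat f (r y .: r).
Proof. by rewrite /inst sat_ren; congr sat; apply/funext; case. Qed.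

(** * Substitution of equal names *)

Definition differ (b : var -> bool) (x y : name) (r s : env) : Prop :=
  forall k, if b k then r k = x /\ s k = y else r k = s k.

(** The realizer may depend on [b], the set of variables that change, but not on the names or
    environments: it passes the given equality on or answers with reflexivity. *)
Lemma differ_eqv b k : {c | forall x y r s, differ b x y r s ->
  ent (eqv x y) c (eqv (r k) (s k))}.
Proof.
case bk: (b k).
  by eexists => x y r s /(_ k); rewrite bk => -[-> ->]; exact: r_id.
by exists (sval eqv_refl) => x y r s /(_ k); rewrite bk => ->; exact: (svalP eqv_refl).
Qed.

Lemma differ_scons b x y r s z : differ b x y r s ->
  differ (fun k => if k is k'.+1 then b k' else false) x y (z .: r) (z .: s).
Proof. by move=> H [|k] //=; exact: H. Qed.

Lemma differ_sym b x y r s : differ b x y r s -> differ b y x s r.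
Proof. by move=> H k; have := H k; case: ifP => // _ []. Qed.

Lemma sat_eqv f b : {c | forall x y r s D, differ b x y r s ->
  ent (eqv x y ** sat f r D) c (sat f s D)}.
Proof.
elim: f b => /= [u v|u v||f IHf g IHg|f IHf g IHg|f IHf g IHg|f IHf|f IHf|f IHf] b.
- have [c Hc] := differ_eqv b u; have [d Hd] := differ_eqv b v.
  eexists => x y r s D H; move: {H}(Hc _ _ _ _ H) (Hd _ _ _ _ H) => Hc' Hd'.

  eapply n_bind; first hyp 0; eapply n_ret; lem mem_eqv.
  eapply r_pair; [eapply r_pair|hyp 0].
    by eapply r_lem; [exact: Hc'|hyp 2].
  by eapply r_lem; [exact: Hd'|hyp 2].
- have [c Hc] := differ_eqv b u; have [d Hd] := differ_eqv b v.
  eexists => x y r s D H; move: {H}(Hc _ _ _ _ H) (Hd _ _ _ _ H) => Hc' Hd'.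
  eapply n_bind; first hyp 0; eapply n_ret; lem eqv_eqv.
  eapply r_pair; [eapply r_pair|hyp 0].
    by eapply r_lem; [exact: Hc'|hyp 2].
  by eapply r_lem; [exact: Hd'|hyp 2].
- by eexists => *; hyp 0.
- have [c Hc] := IHf b; have [d Hd] := IHg b.
  eexists => x y r s D H; move: {H}(Hc _ _ _ _ D H) (Hd _ _ _ _ D H) => Hc' Hd'.
  eapply r_pair; (eapply r_lem; [first [exact: Hc'|exact: Hd']|]);
    (eapply r_pair; [hyp 1|]); [eapply r_fst|eapply r_snd]; hyp 0.
- have [c Hc] := IHf b; have [d Hd] := IHg b.
  eexists => x y r s D H; move: {H}(Hc _ _ _ _ D H) (Hd _ _ _ _ D H) => Hc' Hd'.
  eapply r_lam; eapply r_app; first by hyp 1.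
  eapply r_pair; eapply r_lam.
    eapply r_app; first by eapply r_fst; hyp 1.
    by eapply r_lem; [exact: Hc'|eapply r_pair; [hyp 3|hyp 0]].
  eapply r_app; first by eapply r_snd; hyp 1.
  by eapply r_lem; [exact: Hd'|eapply r_pair; [hyp 3|hyp 0]].
- have [c Hc] := IHf b; have [d Hd] := IHg b.
  eexists => x y r s D H.
  (* The antecedent has to be transported backwards, from [s] to [r]. *)
  move: {H}(Hc _ _ _ _ D (differ_sym H)) (Hd _ _ _ _ D H) => Hc' Hd'.
  eapply r_lam; eapply r_lem; first exact: Hd'.
  eapply r_pair; first hyp 2.
  eapply r_app; first hyp 1.
  eapply r_lem; first exact: Hc'.
  by eapply r_pair; [lem eqv_sym; hyp 2|hyp 0].
- have [c Hc] := IHf (fun k => if k is k'.+1 then b k' else false).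
  eexists => x y r s D H; eapply r_allN => z.
  eapply r_lem; first exact: (Hc _ _ _ _ D (differ_scons z H)).
  by eapply r_pair; [hyp 1|inst1 0 z].
- have [c Hc] := IHf (fun k => if k is k'.+1 then b k' else false).
  eexists => x y r s D H; eapply n_bind; first hyp 0; eapply n_ret.
  eapply r_exL => z; eapply (@r_exI _ _ _ _ z).
  eapply r_lem; first exact: (Hc _ _ _ _ D (differ_scons z H)).
  by eapply r_pair; [hyp 2|hyp 0].
- have [c Hc] := IHf b.
  eexists => x y r s D H; eapply n_bind; first hyp 0; eapply n_ret.
  eapply r_allP => E; eapply r_lem; first exact: (Hc _ _ _ _ E H).
  by eapply r_pair; [hyp 2|inst1 0 E].
Qed.

Lemma sat_eqv0 f : {c | forall x y r D,
  ent (eqv x y ** sat f (x .: r) D) c (sat f (y .: r) D)}.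
Proof.
have [c H] := sat_eqv f (fun k => k == 0).
by exists c => x y r D; apply: H => -[|k].
Qed.

Lemma sat_eqv1 f : {c | forall x y z r D,
  ent (eqv x y ** sat f (z .: x .: r) D) c (sat f (z .: y .: r) D)}.
Proof.
have [c H] := sat_eqv f (fun k => k == 1).
by exists c => x y z r D; apply: H => -[|[|k]].
Qed.

(** * Propositional tautologies, by Kalmár's method *)

Lemma s_em f c d : {e | forall g r D G, ent (G ** sat g r D) c (sat f r D) ->
  ent (G ** (sat g r D ~> D)) d (sat f r D) -> ent G e (sat f r D)}.
Proof.
eexists => g r D G H K; lem (dne f).
eapply r_lam; eapply r_app; first hyp 0.
eapply r_lem; first exact: K.
eapply r_pair; first by eapply r_wk; exact: r_id.
eapply r_lam; eapply r_app; first by hyp 1.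
eapply r_lem; first exact: H.
by eapply r_pair; [do 2 eapply r_wk; exact: r_id|hyp 0].
Qed.

Fixpoint letters (f : form) : seq form :=
  match f with
  | FBot => [::]
  | FAnd f g | FOr f g | FImp f g => letters f ++ letters g
  | _ => [:: f]
  end.

Definition lit (b : bool) f r D : pr := if b then sat f r D else sat f r D ~> D.

Fixpoint lits (v : form -> bool) (L : seq form) r D : pr :=
  if L is f :: L then lits v L r D ** lit (v f) f r D else tt.

Lemma lits_in v L f : List.In f L ->
  exists c, forall r D, ent (lits v L r D) c (lit (v f) f r D).
Proof.
elim: L => //= g L IH [->|/IH[c H]]; eexists => r D; first by hyp 0.
by eapply r_wk.
Qed.

(** Kalmár's lemma; the cases of the induction are the rows of the truth tables. [L] may contain
    further letters, so that two subformulas share one context. *)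
Lemma kalmar v L f : (forall g, List.In g (letters f) -> List.In g L) ->
  exists c, forall r D, ent (lits v L r D) c (lit (prop_val v f) f r D).
Proof.
elim: f => /= [x y|x y||f IHf g IHg|f IHf g IHg|f IHf g IHg|f IHf|f IHf|f IHf] sL;
  try by apply: lits_in; apply: sL; left.
  by eexists => r D; eapply r_lam; hyp 0.
all: have [|c Hc] := IHf; first by move=> h hf; apply: sL; apply/List.in_or_app; left.
all: have [|d Hd] := IHg; first by move=> h hf; apply: sL; apply/List.in_or_app; right.
all: case: (prop_val v f) Hc => Hc; case: (prop_val v g) Hd => Hd;
     rewrite /lit /= in Hc Hd *.
- by eexists => r D; eapply r_pair; [exact: Hc|exact: Hd].
- eexists => r D; eapply r_lam; eapply r_app; first by eapply r_wk; exact: Hd.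
  by eapply r_snd; hyp 0.
- eexists => r D; eapply r_lam; eapply r_app; first by eapply r_wk; exact: Hc.
  by eapply r_fst; hyp 0.
- eexists => r D; eapply r_lam; eapply r_app; first by eapply r_wk; exact: Hc.
  by eapply r_fst; hyp 0.
- eexists => r D; eapply r_lam; eapply r_app; first by eapply r_fst; hyp 0.
  by eapply r_wk; exact: Hc.
- eexists => r D; eapply r_lam; eapply r_app; first by eapply r_fst; hyp 0.
  by eapply r_wk; exact: Hc.
- eexists => r D; eapply r_lam; eapply r_app; first by eapply r_snd; hyp 0.
  by eapply r_wk; exact: Hd.
- eexists => r D; eapply r_lam; eapply r_app; first by hyp 0.
  by eapply r_wk; eapply r_pair; [exact: Hc|exact: Hd].
- by eexists => r D; eapply r_lam; eapply r_wk; exact: Hd.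
- eexists => r D; eapply r_lam; eapply r_app; first by eapply r_wk; exact: Hd.
  by eapply r_app; [hyp 0|eapply r_wk; exact: Hc].
- by eexists => r D; eapply r_lam; eapply r_wk; exact: Hd.
- eexists => r D; eapply r_lam; eapply s_exfalso.
  by eapply r_app; [eapply r_wk; exact: Hc|hyp 0].
Qed.

Definition valid f := exists c, forall r D, ent tt c (sat f r D).

Definition update (v : form -> bool) (f : form) (b : bool) : form -> bool :=
  fun g => if pselect (g = f) then b else v g.

Lemma lits_update v f b L r D : ~ List.In f L ->
  lits (update v f b) L r D = lits v L r D.
Proof.
elim: L => //= g L IH /not_orP[gf /IH ->]; congr prd.
by rewrite /update; case: pselect.
Qed.

(** Literals are discharged one at a time. A letter that recurs in the rest of the list is read off
    there; for any other, excluded middle joins the codes for its two values. *)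
Lemma lits_elim L f :
  (forall v, exists c, forall r D, ent (lits v L r D) c (sat f r D)) -> valid f.
Proof.
elim: L => [/(_ xpredT)//|g L IH H]; apply: IH => v.
case: (pselect (List.In g L)) => gL.
  have [d Hd] := lits_in v gL; have [c Hc] := H v.
  eexists => r D; eapply r_lem; first exact: Hc.
  by eapply r_pair; [exact: r_id|exact: Hd].
have [c Hc] := H (update v g true); have [d Hd] := H (update v g false).
exists (sval (s_em f c d)) => r D; apply: (svalP (s_em f c d) g).
  have := Hc r D; rewrite /= lits_update // /update; by case: pselect.
have := Hd r D; rewrite /= lits_update // /update; by case: pselect.
Qed.

Lemma valid_taut f : tautology f -> valid f.
Proof.
move=> tf; apply: (@lits_elim (letters f)) => v.
have [//|c H] := @kalmar v (letters f) f.
by exists c => r D; have := H r D; rewrite tf.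
Qed.

Lemma valid_mp f g : valid (FImp f g) -> valid f -> valid g.
Proof.
by move=> [c Hc] [d Hd]; eexists => r D; eapply r_app; [exact: Hc|exact: Hd].
Qed.

Lemma valid_gen f : valid f -> valid (FAll f).
Proof. by move=> [c Hc]; eexists => r D; eapply r_allN => x; exact: Hc. Qed.

(** Necessitation is sound because a single code works for every answer type, hence for their
    intersection. *)
Lemma valid_nec f : valid f -> valid (FBox f).
Proof.
by move=> [c Hc]; eexists => r D; eapply n_ret; eapply r_allP => E; exact: Hc.
Qed.

Lemma valid_iff f g : valid (FImp f g) -> valid (FImp g f) -> valid (fiff f g).
Proof.
by move=> [c Hc] [d Hd]; eexists => r D; eapply r_pair; [exact: Hc|exact: Hd].
Qed.

Lemma sat_scons_ren x r f : sat (ren S f) (x .: r) = sat f r.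
Proof. by rewrite sat_ren; congr sat; apply/funext. Qed.

Lemma sat_swap x y r f : sat (ren swap01 f) (x .: y .: r) = sat f (y .: x .: r).
Proof. by rewrite sat_ren; congr sat; apply/funext; case=> [|[]]. Qed.

Lemma valid_axiom f : QeqS4_axiom f -> valid f.
Proof.
case=> {f} [f|f g|f|f|f|f g|f|f y|t|s t f|f].
- exact: valid_taut.
- eexists => r D /=; eapply r_lam; eapply r_lam; eapply n_bind; first by hyp 1.
  eapply n_bind; first by hyp 1.
  eapply n_ret; eapply r_allP => E; eapply r_app; [inst1 1 E|inst1 0 E].
- eexists => r D /=; eapply r_lam; eapply s_bind; first by hyp 0.
  by inst1 0 D.
- eexists => r D /=; eapply r_lam; eapply n_bind; first by hyp 0.
  by eapply n_ret; eapply r_allP => E; eapply n_ret; hyp 0.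
- apply: valid_iff.
    eexists => r D /=; eapply r_lam.
    by rewrite -(sat_scons_ren empty r f); inst1 0 empty.
  eexists => r D /=; eapply r_lam; eapply r_allN => x; rewrite sat_scons_ren; hyp 0.
- eexists => r D /=; do 2 eapply r_lam; eapply r_allN => x.
  eapply r_app; [inst1 1 x|inst1 0 x].
- apply: valid_iff; eexists => r D /=; eapply r_lam;
    eapply r_allN => x; eapply r_allN => y.
    by rewrite sat_swap; inst2 0 y x.
  eapply r_eq; first by inst2 0 y x.
  by rewrite sat_swap.
- by eexists => r D /=; eapply r_lam; rewrite sat_inst; inst1 0 (r y).
- by eexists => r D /=; eapply n_ret; exact: (svalP eqv_refl).
- eexists => r D /=; eapply r_lam; eapply r_lam; rewrite !sat_inst.
  eapply s_bind; first by hyp 1.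
  lem (sat_eqv0 f); eapply r_pair; last by hyp 1.
  by lem eqv_sym; hyp 0.
- apply: valid_iff.
    eexists => r D /=; do 2 eapply r_lam; eapply n_elim; first by hyp 1.
    by eapply r_exL => x; eapply r_app; [inst1 1 x|hyp 0].
  eexists => r D /=; eapply r_lam; eapply r_lam; eapply r_app; first by hyp 1.
  eapply r_allN => x; eapply r_lam; eapply r_app; first by hyp 1.
  by eapply (@r_exI _ _ _ _ x); hyp 0.
Qed.

Lemma soundness (Ax : form -> Prop) f :
  (forall g, Ax g -> valid g) -> provable Ax f -> valid f.
Proof.
move=> vAx; elim=> {f} [f|f|f g _ IHf _ IHg|f _|f _].
- exact: valid_axiom.
- exact: vAx.
- exact: valid_mp IHf IHg.
- exact: valid_gen.
- exact: valid_nec.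
Qed.

Lemma consistency (Ax : form -> Prop) : (forall g, Ax g -> valid g) -> consistent Ax.
Proof.
(* At the empty answer type a realizer of [⊥] would have to return an element of the empty
   predicate. *)
move=> /soundness H /H[c] /(_ (fun=> empty) (fun=> False)) /(_ 0 (Logic.I : tt 0)).
by case.
Qed.

(** * The axioms of eZF *)

(** The truth value of [□ ∀z (z ∈ x ⇒ z ∈ y)] without its outer double negation. *)
Definition bsub (x y : name) : pr :=
  pall (fun E => pall (fun z => nn E (mem z x) ~> nn E (mem z y))).

(* Taking the answer type to be [mem z y] itself. *)
Lemma bsub_sub : {c | forall x y, ent (bsub x y) c (sub x y)}.
Proof.
eexists => x y; eapply r_lamA => z; eapply n_run.
eapply r_app; first by inst2 1 (mem z y) z.
by eapply n_ret; hyp 0.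
Qed.

Lemma sub_bsub : {c | forall x y, ent (sub x y) c (bsub x y)}.
Proof.
eexists => x y; eapply r_allP => E; eapply r_lamA => z.
by eapply n_bind; [hyp 0|eapply n_ret; eapply r_app; [inst1 2 z|hyp 0]].
Qed.

(** [x] is the set of the [z] such that [P z]. *)
Definition bset (x : name) (P : name -> pr -> pr) : pr :=
  pall (fun E => pall (fun z => (nn E (mem z x) ~> P z E) ** (P z E ~> nn E (mem z x)))).

Lemma bset_uniq : {c | forall x y P, ent (bset x P ** bset y P) c (eqv x y)}.
Proof.
eexists => x y P; lem sub_eqv; eapply r_pair; lem bsub_sub;
  eapply r_allP => E; eapply r_lamA => z.
- eapply r_app; first by eapply r_snd; inst2 1 E z.
  by eapply r_app; [eapply r_fst; inst2 2 E z|hyp 0].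
- eapply r_app; first by eapply r_snd; inst2 2 E z.
  by eapply r_app; [eapply r_fst; inst2 1 E z|hyp 0].
Qed.

Lemma valid_extensionality :
  valid (∀' ∀' (□ (∀' (0 ∈ 2 ⇔ 0 ∈ 1)) ⇒ 1 ≡ 0))%modal.
Proof.
eexists => r D /=; eapply r_allN => x; eapply r_allN => y; eapply r_lam.
eapply n_bind; first hyp 0; eapply n_ret.
(* The premise says that [x] is the set of the elements of [y], and [y] trivially is that set
   too. *)
eapply r_lem; first exact: (svalP bset_uniq x y (fun z E => nn E (mem z y))).
eapply r_pair; first hyp 0.
by eapply r_allP => E; eapply r_allN => z; eapply r_pair; eapply r_lam; hyp 0.
Qed.

Lemma sat_skip1 f z y r : sat (ren (up S) f) (z .: y .: r) = sat f (z .: r).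
Proof. by rewrite sat_ren scons_up. Qed.

Lemma sat_skip2 f z y x r :
  sat (ren (up (up S)) f) (z .: y .: x .: r) = sat f (z .: y .: r).
Proof. by rewrite sat_ren !scons_up. Qed.

(** Recursion along [child]. What is constructed recursively is the whole intersection [bx f], since
    the boxed induction hypothesis asks for every answer type. *)
Lemma valid_foundation f :
  valid ((□ ∀' (□ (all_in 0 (ren (up S) f)) ⇒ f)) ⇒ □ ∀' f)%modal.
Proof.
eexists => r D /=; eapply r_lam; eapply n_bind; first hyp 0; eapply n_ret.
cut_by ltac:(eapply r_allN; eapply (@r_fix _ _ id _ (fun=> tt)
                (fun x => bx f (x .: r)) _ _ child_wf)).
  move=> x; eapply r_lam; eapply r_allP => E; eapply r_app.
    by inst2 2 E x.
  eapply n_ret; eapply r_allP => E'; eapply r_allN => y; eapply r_lam.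
  rewrite sat_skip1; eapply s_bind; first hyp 0.
  eapply r_exL => i; eapply r_prdL; lem (sat_eqv0 f).
  eapply r_pair; first by lem eqv_sym; hyp 0.
  inst_by E' ltac:(eapply r_app; last triv).
  by inst2 4 (el i) (child_el i).
eapply r_allP => E; eapply r_allN => x.
inst_by E ltac:(eapply r_app; last triv).
by inst1 0 x.
Qed.

(** The tags 0 for [x] and 1 for [y] tell a program which disjunct to realize. *)
Definition upair (x y : name) : name :=
  sup (fun b : bool => if b then x else y) (fun b => num (~~ b)).

Lemma valid_pairing : valid (∀' ∀' ∃' is_upair 2 1 0)%modal.
Proof.
eexists => r D /=; eapply r_allN => x; eapply r_allN => y.
eapply n_ret; eapply (@r_exI _ _ _ _ (upair x y)); eapply n_ret.
eapply r_allP => E; eapply r_allN => u; eapply r_pair; eapply r_lam.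
  eapply (s_bind (f := (0 ≡ 3 ∨ 0 ≡ 2)%modal) (r := u .: upair x y .: y .: x .: r)).
    hyp 0.
  eapply r_exL => b; eapply r_prdL.
  eapply (svalP (r_case _ _ _)); last by hyp 1.
    case: b => // _; eapply (svalP (r_orI1 _)); eapply n_ret; hyp 0.
  case: b => // m _; eapply (svalP (r_orI2 _)); eapply n_ret; hyp 1.
eapply (svalP (r_orE _ _ _)); first hyp 0.
  eapply n_bind; first hyp 0; eapply n_ret; eapply (@r_exI _ _ _ _ true).
  by eapply r_pair; [exact: r_0|hyp 0].
eapply n_bind; first hyp 0; eapply n_ret; eapply (@r_exI _ _ _ _ false).
by eapply r_pair; [eapply r_S; exact: r_0|hyp 0].
Qed.

Definition unionn (x : name) : name :=
  sup (fun p : {i : idx x & idx (el i)} => el (tagged p))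
      (fun p => rl (tag p) ** rl (tagged p)).

Lemma valid_unions :
  valid (∀' ∃' □ ∀' (0 ∈ 1 ⇔ ∃' (0 ∈ 3 ∧ 1 ∈ 0)))%modal.
Proof.
eexists => r D /=; eapply r_allN => x.
eapply n_ret; eapply (@r_exI _ _ _ _ (unionn x)); eapply n_ret.
eapply r_allP => E; eapply r_allN => z; eapply r_pair; eapply r_lam.
  eapply n_bind; first hyp 0; eapply n_ret.
  eapply r_exL => -[i j]; eapply r_prdL; eapply (@r_exI _ _ _ _ (el i)).
  eapply r_pair; eapply n_ret; first by lem mem_el; eapply r_fst; hyp 1.
  by eapply (@r_exI _ _ _ _ j); eapply r_pair; [eapply r_snd; hyp 1|hyp 0].
eapply n_bind; first hyp 0; eapply r_exL => v; eapply r_prdL.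
eapply n_bind; first hyp 1; eapply n_bind; first hyp 1; eapply n_ret.
cut_by ltac:(hyp 1); eapply r_exL => i; eapply r_prdL.
cut_by ltac:(eapply r_app; [inst_by z ltac:(lem eqv_sub; hyp 0)|hyp 2]).
eapply r_exL => j; eapply r_prdL; eapply (@r_exI _ _ _ _ (existT _ i j)).
by eapply r_pair; [eapply r_pair; [hyp 3|hyp 1]|hyp 0].
Qed.

Definition sep (x : name) (P : name -> pr) : name :=
  sup (@el x) (fun i => rl i ** P (el i)).

(** The box is essential: [bx f] does not mention the answer type, so one separated name serves all
    of them. *)
Lemma valid_comprehension f :
  valid (∀' ∃' □ ∀' (0 ∈ 1 ⇔ (0 ∈ 2 ∧ □ ren (up S) f)))%modal.
Proof.
eexists => r D /=; eapply r_allN => x; eapply n_ret.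
eapply (@r_exI _ _ _ _ (sep x (fun z => bx f (z .: x .: r)))); eapply n_ret.
eapply r_allP => E; eapply r_allN => z.
rewrite sat_skip1; eapply r_pair; eapply r_lam.
  eapply r_pair; (eapply n_bind; first hyp 0);
    eapply r_exL => i; eapply r_prdL; eapply n_ret.
    by eapply (@r_exI _ _ _ _ i); eapply r_pair; [eapply r_fst; hyp 1|hyp 0].
  eapply r_allP => E'; lem (sat_eqv0 f); eapply r_pair; first by lem eqv_sym; hyp 0.
  by inst_by E' ltac:(eapply r_snd; hyp 1).
eapply n_bind; first by eapply r_fst; hyp 0.
eapply n_bind; first by eapply r_snd; hyp 1.
eapply n_ret; cut_by ltac:(hyp 1); eapply r_exL => i; eapply r_prdL.
eapply (@r_exI _ _ _ _ i); eapply r_pair; last hyp 0.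
eapply r_pair; first hyp 1.
eapply r_allP => E'; lem (sat_eqv0 f); eapply r_pair; first by hyp 0.
by inst1 2 E'.
Qed.

Definition subname (x : name) (T : idx x -> pr) : name := sup (@el x) T.
(** Up to [eqv], every subset of [x] arises from the elements of [x] by choosing new realizers
    [T]. *)
Definition power (x : name) : name :=
  sup (@subname x) (fun T => sub (subname T) x).

Lemma valid_power_set :
  valid (∀' ∃' □ ∀' (0 ∈ 1 ⇔ □ ∀' (0 ∈ 1 ⇒ 0 ∈ 3)))%modal.
Proof.
eexists => r D /=; eapply r_allN => x; eapply n_ret.
eapply (@r_exI _ _ _ _ (power x)); eapply n_ret.
eapply r_allP => E; eapply r_allN => z; eapply r_pair; eapply r_lam;
  (eapply n_bind; first hyp 0); eapply n_ret.
  eapply r_exL => T; eapply r_prdL; lem sub_bsub; eapply r_lamA => u.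
  eapply r_app; first by inst1 2 u.
  by eapply r_app; [inst_by u ltac:(lem eqv_sub; hyp 1)|hyp 0].
cut_by ltac:(lem bsub_sub; hyp 0).
(* The subset [z] is reindexed by [x], with the realizers of membership in [z] as tags. *)
pose T (i : idx x) := mem (el i) z; eapply (@r_exI _ _ _ _ T).
cut_by ltac:(idtac).
  eapply (@r_lamA _ _ (fun u => mem u (subname T)) (fun u => mem u z)) => u.
  eapply r_exL => i; eapply r_prdL; lem mem_eqvl.
  by eapply r_pair; [hyp 0|hyp 1].
eapply r_pair.
  eapply r_lamA => u; eapply r_app; first by inst1 2 u.
  by eapply r_app; [inst1 1 u|hyp 0].
lem sub_eqv; eapply r_pair; last hyp 0.
eapply r_lamA => u; cut_by ltac:(eapply r_app; [inst1 2 u|hyp 0]).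
eapply r_exL => i; eapply r_prdL; eapply (@r_exI _ _ _ _ i).
eapply r_pair; last hyp 0.
by lem mem_eqvl; eapply r_pair; [lem eqv_sym; hyp 0|hyp 2].
Qed.

Definition some_name (P : name -> Prop) : name :=
  if pselect (exists z, P z) is left h then sval (cid h) else empty.

Lemma some_nameP P z : P z -> P (some_name P).
Proof.
rewrite /some_name => Pz; case: pselect => [h|[]]; last by exists z.
exact: svalP.
Qed.

(* Indexing by realizers makes the choice of a witness depend only on data
   that the realizer of the premise provides. *)
Definition coll (x : name) (P : name -> name -> pr) : name :=
  sup (fun p : idx x * nat => some_name (fun z => P (el p.1) z p.2)) (fun=> tt).

Lemma valid_collection u f :
  valid (all_in u (∃' □ f) ⇒
    ∃' (all_in u.+1 (ex_in 1 (□ ren (up (up S)) f))))%modal.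
Proof.
eexists => r D /=; eapply r_lam; eapply n_ret.
eapply (@r_exI _ _ _ _ (coll (r u) (fun y z => bx f (z .: y .: r)))).
eapply r_allN => y; eapply r_lam; eapply n_bind; first hyp 0.
eapply r_exL => i; eapply r_prdL; eapply n_bind.
  eapply r_app; first by inst1 3 (el i).
  by eapply n_ret; lem mem_el; hyp 1.
eapply r_exL => z0; eapply n_bind; first hyp 0.
(* The realizer [n] at hand becomes the second component of the index into [coll]; the chosen
   witness may differ from [z0] but is realized by the same [n]. *)
eapply r_reify => n Hn; set P := fun y z => bx f (z .: y .: r).
have Hz := @some_nameP (fun z => P (el i) z n) _ Hn.
eapply n_ret; eapply r_exI; eapply r_pair; eapply n_ret.
  eapply (@r_exI _ _ _ _ ((i, n) : idx (coll (r u) P))).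
  eapply r_pair; first triv.
  exact: (svalP eqv_refl).
rewrite sat_skip2; eapply r_allP => E; lem (sat_eqv1 f).
eapply r_pair; first by lem eqv_sym; hyp 2.
by inst_by E ltac:(eapply r_lem; [exact (r_num Hz)|hyp 0]).
Qed.

(** * Numerals *)

Definition bzero (z : name) : pr := pall (fun E => pall (fun v => nn E (mem v z) ~> E)).
Definition bsucc (y z : name) : pr :=
  bset z (fun v E => orr E (nn E (mem v y)) (nn E (eqv v y))).

Lemma zero_real : {c | forall G, ent G c (bzero empty)}.
Proof.
eexists => G; eapply r_allP => E; eapply r_lamA => v.
by eapply n_elim; [hyp 0|eapply (@r_exL _ _ _ _ cId) => -[]].
Qed.

Lemma zero_uniq : {c | forall z, ent (bzero z) c (eqv z empty)}.
Proof.
eexists => z; lem sub_eqv; eapply r_pair; eapply r_lamA => v.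
  (* The desired membership is itself the answer type, so the refutation of [v ∈ z] returns it. *)
  by eapply r_app; [inst2 1 (mem v empty) v|eapply n_ret; hyp 0].
by eapply (@r_exL _ _ _ _ cId) => -[].
Qed.

(* The tags [num 0], [num 1] tell the elements of [y] from [y] itself. *)
Definition nsucc (y : name) : name :=
  sup (fun o : option (idx y) => if o is Some i then el i else y)
      (fun o => num (~~ o) ** (if o is Some i then rl i else tt)).

Lemma succ_real : {c | forall G y, ent G c (bsucc y (nsucc y))}.
Proof.
eexists => G y; eapply r_allP => E; eapply r_allN => v; eapply r_pair; eapply r_lam.
  eapply r_lam; eapply n_elim; first hyp 1.
  eapply r_exL => o; eapply r_prdL.
  change (@rl (nsucc y) o) with (num (~~ o) ** (if o is Some i then rl i else tt)).
  cut_by ltac:(eapply r_fst; hyp 1); cut_by ltac:(eapply r_snd; hyp 2).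
  eapply (proj2_sig (r_case _ _ _)); last by hyp 1.
    case: o => // i _; eapply r_app; first by eapply r_fst; hyp 4.
    by eapply n_ret; eapply (@r_exI _ _ _ _ i); eapply r_pair; [hyp 0|hyp 2].
  case: o => // m _; eapply r_app; first by eapply r_snd; hyp 5.
  by eapply n_ret; hyp 3.
eapply (proj2_sig (r_orE _ _ _)); first hyp 0.
  eapply n_bind; first hyp 0; eapply n_ret.
  eapply r_exL => i; eapply r_prdL; eapply (@r_exI _ _ _ _ (Some i)).
  by eapply r_pair; [eapply r_pair; [exact: r_0|hyp 1]|hyp 0].
eapply n_bind; first hyp 0; eapply n_ret; eapply (@r_exI _ _ _ _ None).
eapply r_pair; last hyp 0.
by eapply r_pair; [eapply r_S; exact: r_0|triv].
Qed.

Lemma succ_uniq : {c | forall y z, ent (bsucc y z) c (eqv z (nsucc y))}.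
Proof.
eexists => y z.
eapply r_lem; first exact: (svalP bset_uniq z (nsucc y)
  (fun v E => orr E (nn E (mem v y)) (nn E (eqv v y)))).
by eapply r_pair; [hyp 0|exact: (svalP succ_real)].
Qed.

Definition nm (n : nat) : name := iter n nsucc empty.
(** By the tags, a realizer of membership in [omega] determines the number. *)
Definition omega : name := sup nm num.

Lemma omega_inductive : {c | forall G r, ent G c (bx (inductive_set 0) (omega .: r))}.
Proof.
eexists => G r; eapply r_allP => E; eapply r_pair.
  eapply n_ret; eapply (@r_exI _ _ _ _ empty); eapply r_pair; eapply n_ret.
    eapply (@r_exI _ _ _ _ (0 : idx omega)).
    by eapply r_pair; [exact: r_0|exact: (svalP eqv_refl)].
  exact: (svalP zero_real).
eapply r_lamA => y; eapply n_bind; first hyp 0; eapply n_ret.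
eapply r_exL => n; eapply r_prdL; eapply (@r_exI _ _ _ _ (nm n.+1)).
eapply r_pair.
  eapply n_ret; eapply (@r_exI _ _ _ _ (n.+1 : idx omega)).
  by eapply r_pair; [eapply r_S; hyp 1|exact: (svalP eqv_refl)].
eapply r_lem; first exact: (svalP (sat_eqv1 (is_succ 1 0)) (nm n) y (nm n.+1) r E).
eapply r_pair; first by lem eqv_sym; hyp 0.
eapply n_ret; exact: (svalP succ_real).
Qed.

Lemma valid_infinity : valid (∃' □ inductive_set 0)%modal.
Proof.
eexists => r D; eapply n_ret; eapply (@r_exI _ _ _ _ omega); eapply n_ret.
exact: (svalP omega_inductive).
Qed.

(** * Least sets, and the natural numbers of the model *)

Definition least (C : var -> form) (x : name) (r : env) : pr :=
  pall (fun u => bx (C 0) (u .: r) ~> mem x u).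

Lemma least_in : {c | forall C x r D,
  ent (least C (r x) r) c (sat (in_least C x) r D)}.
Proof.
eexists => C x r D; eapply n_ret; eapply r_allP => E; eapply r_lamA => u.
eapply n_bind; first hyp 0; eapply n_ret.
by eapply r_app; [inst1 2 u|hyp 0].
Qed.

Lemma nat_in_omega : {c | forall x r D,
  ent (sat (is_nat x) r D) c (nn D (mem (r x) omega))}.
Proof.
eexists => x r D; eapply n_bind; first hyp 0.
eapply r_app; first by inst2 0 D omega.
eapply n_ret; exact: (svalP omega_inductive).
Qed.

(** Recursion on [n] inside an arbitrary inductive [u]. Each use of the hypothesis on [u] takes the
    membership to be shown as answer type, which strips the double negations. *)
Lemma nat_real : {c | forall x r n D, r x = nm n ->
  ent (num n) c (sat (is_nat x) r D)}.
Proof.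
eexists => x r n D rx; lem least_in; rewrite rx; eapply r_lamA => u.
eapply (@r_rec _ (fun k => mem (nm k) u)); last by hyp 1.
  eapply n_elim; first by eapply r_fst; inst1 0 (mem (nm 0) u).
  eapply r_exL => z; eapply r_prdL; eapply n_elim; first hyp 1.
  eapply n_elim; first hyp 1.
  lem mem_eqvl; eapply r_pair; last by hyp 1.
  by lem eqv_sym; lem zero_uniq; hyp 0.
move=> k; eapply r_prdL; eapply n_elim.
  eapply r_app; last by eapply n_ret; hyp 0.
  inst_by (nm k) ltac:(eapply r_snd; inst1 2 (mem (nm k.+1) u)).
eapply r_exL => z; eapply r_prdL; eapply n_elim; first hyp 1.
eapply n_elim; first hyp 1.
lem mem_eqvl; eapply r_pair; last by hyp 1.
by lem eqv_sym; lem succ_uniq; hyp 0.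
Qed.

(** * Cantor's pairing and the values of patterns *)

Definition triple (a b c u : name) (E : pr) : pr :=
  sat (triple_in 3 2 1 0) (u .: c .: b .: a .: (fun=> empty)) E.

Lemma triple_sat x y z w r E :
  sat (triple_in x y z w) r E = triple (r x) (r y) (r z) (r w) E.
Proof. by []. Qed.

Lemma cfstS n : cfst n.+1 = if csnd n is _.+1 then (cfst n).+1 else 0.
Proof. by rewrite /cfst /csnd /= /cnext; case: (cunpair n) => a []. Qed.

Lemma csndS n : csnd n.+1 = if csnd n is b.+1 then b else (cfst n).+1.
Proof. by rewrite /cfst /csnd /= /cnext; case: (cunpair n) => a []. Qed.

(** Recursion on the code: the pair coded by [k.+1] comes from the one coded by [k] through one
    clause of [pairing_closed], and whether [csnd k] is zero decides which. *)
Lemma pairing_triple : {c | forall n u r E,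
  ent (num n ** bx (pairing_closed 0) (u .: r)) c
      (triple (nm (cfst n)) (nm (csnd n)) (nm n) u E)}.
Proof.
eexists => n u r E.
eapply (@r_rec _ (fun n => triple (nm (cfst n)) (nm (csnd n)) (nm n) u E)); last by hyp 1.
  eapply r_app; first by inst_by empty ltac:(eapply r_fst; inst1 0 E).
  by eapply n_ret; exact: (svalP zero_real).
move=> k; eapply r_prdL.
rewrite cfstS csndS.
eapply (proj2_sig (r_case _ _ _) _ _ (csnd k)); last by eapply r_csnd; hyp 1.
  move=> k0; rewrite k0 /=.
  eapply r_app.
    inst_by (nm k.+1) ltac:(inst_by (nm k) ltac:(inst_by (nm (cfst k).+1)
      ltac:(inst_by (nm (cfst k)) ltac:(inst_by empty
        ltac:(eapply r_fst; eapply r_snd; inst1 2 E))))).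
  eapply r_pair; first by eapply n_ret; exact: (svalP zero_real).
  do 2 (eapply r_pair; [eapply n_ret; exact: (svalP succ_real)|]).
  by hyp 0.
move=> m km; rewrite km /=.
eapply r_app.
  inst_by (nm k.+1) ltac:(inst_by (nm k) ltac:(inst_by (nm m.+1) ltac:(inst_by (nm m)
    ltac:(inst_by (nm (cfst k).+1) ltac:(inst_by (nm (cfst k))
      ltac:(eapply r_snd; eapply r_snd; inst1 3 E)))))).
do 3 (eapply r_pair; [eapply n_ret; exact: (svalP succ_real)|]).
by hyp 1.
Qed.

Lemma cpair_real : {c | forall x y z r a b D,
  r x = nm a -> r y = nm b -> r z = nm (cpair a b) ->
  ent (num (cpair a b)) c (sat (is_cpair x y z) r D)}.
Proof.
eexists => x y z r a b D rx ry rz; eapply n_ret; eapply r_allP => E.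
eapply (@r_lamA _ _ (fun u => nn E (bx (pairing_closed 0) (u .: r)))
  (fun u => sat (triple_in x.+1 y.+1 z.+1 0) (u .: r) E)) => u.
rewrite triple_sat /scons rx ry rz.
eapply n_bind; first hyp 0.
eapply r_eq; first by lem pairing_triple; eapply r_pair; [hyp 2|hyp 0].
by rewrite cpair1 cpair2.
Qed.

Fixpoint pvars (t : pat) : seq nat :=
  match t with
  | PVar i => [:: i]
  | PZero => [::]
  | PSucc t => pvars t
  | PPair t u => pvars t ++ pvars u
  end.

Fixpoint peval (w : nat -> nat) (t : pat) : nat :=
  match t with
  | PVar i => w i
  | PZero => 0
  | PSucc t => (peval w t).+1
  | PPair t u => cpair (peval w t) (peval w u)
  end.

(** Here [w i] is a program for the variable [i], not its value. *)
Fixpoint pcode (w : nat -> nat) (t : pat) : nat :=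
  match t with
  | PVar i => w i
  | PZero => cConst 0
  | PSucc t => cComp cSucc (pcode w t)
  | PPair t u => cPair (pcode w t) (pcode w u)
  end.

Lemma pcode_real G c w t : (forall i, i \in pvars t -> ent G (c i) (num (w i))) ->
  ent G (pcode c t) (num (peval w t)).
Proof.
elim: t => [i|_|t IH|t IHt u IHu] /=.
- by apply; rewrite inE.
- exact: r_0.
- by move=> /IH; exact: r_S.
- move=> H; apply: r_cpair; [apply: IHt|apply: IHu] => i it; apply: H;
    by rewrite mem_cat it ?orbT.
Qed.

Lemma value_real t (c : nat -> nat) : {d | forall G w p x r D,
  (forall i, i \in pvars t -> ent G (c i) (num (w i))) ->
  (forall i, i \in pvars t -> r (p i) = nm (w i)) ->
  r x = nm (peval w t) -> ent G d (sat (is_value p t x) r D)}.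
Proof.
elim: t => [i||t [d IH]|t [d IHt] u [e IHu]] /=.
- eexists => G w p x r D _ H ->; rewrite H ?inE //; eapply n_ret.
  exact: (svalP eqv_refl).
- eexists => G w p x r D _ _ /= ->; eapply n_ret; exact: (svalP zero_real).
- eexists => G w p x r D Hc Hw rx; eapply n_ret.
  eapply (@r_exI _ _ _ _ (nm (peval w t))); eapply r_pair; first exact: (IH _ w).
  by eapply n_ret => /=; rewrite rx; exact: (svalP succ_real).
- eexists => G w p x r D Hc Hw rx; eapply n_ret.
  eapply (@r_exI _ _ _ _ (nm (peval w t))); eapply n_ret.
  eapply (@r_exI _ _ _ _ (nm (peval w u))); eapply r_pair; last eapply r_pair.
  + apply: (IHt _ w) => // i it; first by apply: Hc; rewrite mem_cat it.
    by apply: Hw; rewrite mem_cat it.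
  + apply: (IHu _ w) => // i it; first by apply: Hc; rewrite mem_cat it orbT.
    by apply: Hw; rewrite mem_cat it orbT.
  + eapply r_lem.
      exact: (svalP cpair_real 1 0 x.+2 (nm (peval w u) .: nm (peval w t) .: r)
        (peval w t) (peval w u) D erefl erefl rx).
    exact (@pcode_real G c w (PPair t u) Hc).
Qed.

(** * Codes of computations *)

Lemma conj_nth k : {c | forall s r D, k < size s ->
  ent (sat (conj s) r D) c (sat (nth FBot s k) r D)}.
Proof.
elim: k => [|k [c IH]]; eexists => -[|f s] r D //= ks; first by eapply r_fst; hyp 0.
by eapply r_lem; [exact: IH|eapply r_snd; hyp 0].
Qed.

Definition nums (ws : seq nat) : pr := foldr (fun n P => num n ** P) tt ws.
Definition mems (u : name) (ws : seq nat) : pr :=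
  foldr (fun n P => mem (nm n) u ** P) tt ws.

Fixpoint proj (i : nat) : nat := if i is i.+1 then cComp (proj i) cSnd else cFst.

Lemma nums_nth ws i : i < size ws -> ent (nums ws) (proj i) (num (nth 0 ws i)).
Proof.
elim: ws i => [//|n ws IH] [_|i /IH iws]; first exact: r_drop.
eapply r_lem; [exact: iws|exact: r_var].
Qed.

Definition with_nums (ws : seq nat) (r : env) : env :=
  fun k => if k < size ws then nm (nth 0 ws k) else r (k - size ws).

(** The outermost quantifier binds the variable with the largest index, hence the induction from the
    end of [ws]. *)
Lemma sat_iter_all ws f r D G c : ent G c (sat (iter (size ws) FAll f) r D) ->
  ent G c (sat f (with_nums ws r) D).
Proof.
elim/last_ind: ws r => [|ws n IH] r.
  by move=> H; eapply r_eq; [exact: H|congr sat; apply/funext => k; rewrite /with_nums subn0].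
rewrite size_rcons /= => H; eapply r_eq.
  by apply: (IH (nm n .: r)); inst_by (nm n) ltac:(exact: H).
congr sat; apply/funext => k; rewrite /with_nums size_rcons nth_rcons ltnS.
case: ltngtP => // [k1|->]; last by rewrite subnn.
by rewrite -(subnSK k1).
Qed.

Definition scoped_rule (R : comp_rule) : bool :=
  all (fun t => all (fun i => i < rule_arity R) (pvars t))
      (rule_conclusion R :: rule_premises R).

Lemma premises_real ps : {c | forall ws u x r D,
  all (fun t => all (fun i => i < size ws) (pvars t)) ps ->
  (forall i, i < size ws -> r i.+1 = nm (nth 0 ws i)) -> r x = u ->
  ent (nums ws ** mems u [seq peval (nth 0 ws) p | p <- ps]) c
    (sat (conj [seq FEx (FAnd (is_value (fun i => i.+2) p 0) (FMem 0 x.+1)) | p <- ps]) r D)}.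
Proof.
elim: ps => [|p ps [c IH]] /=.
  by eexists => ws u x r D _ _ _; eapply r_lam; hyp 0.
eexists => ws u x r D /andP[/allP sp sps] Hw rx; eapply r_pair; last first.
  eapply r_lem; first exact: (IH ws u x r D).
  by eapply r_pair; [hyp 1|eapply r_snd; hyp 0].
eapply n_ret; eapply (@r_exI _ _ _ _ (nm (peval (nth 0 ws) p))); eapply r_pair.
  apply: (svalP (value_real p (fun i => cComp (proj i) cFst)) _ (nth 0 ws)) => // i /sp iws.
    by eapply r_lem; [exact: nums_nth|exact: r_drop].
  by rewrite /= Hw.
by eapply n_ret => /=; rewrite rx; eapply r_fst; hyp 0.
Qed.

(** The default value for [nth] on lists of rules. *)
Definition rule0 := Rule 0 [::] PZero.

Lemma rule_real k R : {c | forall ws u r, nth rule0 comp_rules k = R ->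
  k < size comp_rules -> scoped_rule R -> size ws = rule_arity R ->
  ent (bx (comp_closed 0) (u .: r) **
      (nums ws ** mems u [seq peval (nth 0 ws) p | p <- rule_premises R])) c
    (mem (nm (peval (nth 0 ws) (rule_conclusion R))) u)}.
Proof.
case: R => n ps t.
eexists => ws u r kR hk sR /= hws; set q := nm _.
(* The closure conditions are applied at the answer type [A], the very membership wanted. *)
eapply n_run; set A := mem q u.
eapply r_cut.
  eapply r_lem.
    apply: (svalP (conj_nth k) [seq rule_closed 0 R | R <- comp_rules] (u .: r) A).
    by rewrite size_map.
  by eapply r_eq; [eapply (@r_allE _ _ _ _ A); exact: r_drop|reflexivity].
rewrite (nth_map rule0) // kR /rule_closed -hws.
cut_by ltac:(eapply (@sat_iter_all ws); hyp 0).
cut_by ltac:(inst1 0 q).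
have Eu : with_nums ws (u .: r) (size ws + 0) = u.
  by rewrite /with_nums addn0 ltnn subnn.
eapply (@r_eq _ (nn A (mem q (with_nums ws (u .: r) (size ws + 0)))));
  last by rewrite Eu.
eapply r_app; first hyp 0.
move: sR; rewrite /scoped_rule /= => /andP[/allP st sps].
have Hw i : i < size ws -> (q .: with_nums ws (u .: r)) i.+1 = nm (nth 0 ws i).
  by move=> iws; rewrite /= /with_nums iws.
eapply r_pair.
  eapply r_lem; last by do 3 eapply r_wk; exact: r_var.
  apply: (svalP (premises_real ps)); [by rewrite hws| exact: Hw|exact: Eu].
apply: (svalP (value_real t (fun i => cComp (proj i)
   (cComp cFst (cComp (cComp (cComp cSnd cFst) cFst) cFst)))) _ (nth 0 ws)) => // i /st it.
  eapply r_lem; first by apply: nums_nth; rewrite hws.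
  by eapply r_fst; do 3 eapply r_wk; exact: r_var.
by apply: Hw; rewrite hws.
Qed.

(** * Tracing a program: from its code and input to the code of the computation *)

Definition node e x y s := cpair (cpair e (cpair x y)) s.

(** The content of [is_comp] at the numeral of [q], for all environments at once. *)
Definition is_computation (q : nat) : pr :=
  pall (fun p : env * name => bx (comp_closed 0) (p.2 .: p.1) ~> mem (nm q) p.2).

(** The tracer receives [e] and [x] only; the height and the output are known merely to exist. *)
Definition called (p : nat * nat * nat * nat) : pr :=
  let: (h, e, x, y) := p in pex (fun _ : compn h e x y => num e ** num x).
Definition traced (p : nat * nat * nat * nat) : pr :=
  let: (h, e, x, y) := p in
  pex (fun s => num (node e x y s) ** is_computation (node e x y s)).
Definition traced_below (h : nat) : pr :=
  pall (fun p : nat * nat * nat * nat =>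
    pall (fun _ : p.1.1.1 < h => called p ~> traced p)).

Lemma trace_call : {c | forall h k e x y, k < h -> compn k e x y ->
  ent (traced_below h ** num e ** num x) c (traced (k, e, x, y))}.
Proof.
eexists => h k e x y hk run; eapply r_app; first by inst2 2 (k, e, x, y) hk.
by eapply (@r_exI _ _ _ _ run); eapply r_pair; [hyp 1|hyp 0].
Qed.

Definition comps (qs : seq nat) : pr := foldr (fun q P => is_computation q ** P) tt qs.

Lemma comps_mems ps : {c | forall w u r,
  ent (comps [seq peval w p | p <- ps] ** bx (comp_closed 0) (u .: r)) c
      (mems u [seq peval w p | p <- ps])}.
Proof.
elim: ps => [|p ps [c IH]]; eexists => w u r; first triv.
eapply r_pair.
  eapply r_app; last by hyp 0.
  by inst_by (r, u) ltac:(eapply r_fst; exact: r_drop).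
eapply r_lem; first exact: IH.
by eapply r_pair; [eapply r_snd; exact: r_drop|hyp 0].
Qed.

Lemma trace_rule k R : {c | forall ws,
  nth rule0 comp_rules k = R -> k < size comp_rules -> scoped_rule R ->
  size ws = rule_arity R ->
  ent (nums ws ** comps [seq peval (nth 0 ws) p | p <- rule_premises R]) c
    (num (peval (nth 0 ws) (rule_conclusion R)) **
     is_computation (peval (nth 0 ws) (rule_conclusion R)))}.
Proof.
eexists => ws kR hk sR hws; eapply r_pair.
  apply: (@pcode_real _ (fun i => cComp (proj i) cFst)) => i it.
  eapply r_lem; last exact: r_drop; apply: nums_nth; rewrite hws.
  by case/andP: sR => /allP/(_ _ it).
eapply r_lamA => -[r u]; eapply r_lem; first exact: (svalP (rule_real k R) ws u r).
eapply r_pair; first hyp 0.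
eapply r_pair; first by eapply r_wk; exact: r_drop.
lem (comps_mems (rule_premises R)); eapply r_pair; last hyp 0.
by eapply r_wk; exact: r_var.
Qed.

Lemma node_out : {c | forall e x y s, ent (num (node e x y s)) c (num y)}.
Proof.
eexists => e x y s; eapply r_eq.
  by eapply r_csnd; eapply r_csnd; eapply r_cfst; exact: r_id.
by rewrite !(cpair1, cpair2).
Qed.

Lemma node_sub : {c | forall e x y s, ent (num (node e x y s)) c (num s)}.
Proof.
by eexists => e x y s; eapply r_eq; [eapply r_csnd; exact: r_id|rewrite cpair2].
Qed.

Ltac proj_num tac := eapply r_eq; [tac|by rewrite !(cpair1, cpair2)].
Ltac num_fst tac := proj_num ltac:(eapply r_cfst; tac).
Ltac num_snd tac := proj_num ltac:(eapply r_csnd; tac).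

Definition tracing k := {c | forall h e x y, compn h e x y -> cfst e = k ->
  ent (traced_below h ** num e ** num x) c (traced (h, e, x, y))}.

Ltac trace_cases :=
  let h := fresh in let e := fresh in let x := fresh in let y := fresh in
  let run := fresh in
  move=> h e x y run; case: run; clear h e x y; try (by move=> >; rewrite cpair1).
Ltac by_rule k ws := eapply r_exI; eapply r_lem;
  [exact: (svalP (trace_rule k (nth rule0 comp_rules k)) ws erefl isT isT erefl)|].
Ltac call h k e x y run := eapply r_cut;
  [eapply r_lem; [exact: (svalP trace_call h k e x y (ltnSn _) run)|]|].

Lemma trace0 : tracing 0.
Proof.
eexists; trace_cases => h c x _; by_rule 0 [:: x; c].
eapply r_pair; last triv.
eapply r_pair; first hyp 0; eapply r_pair; last triv.
by num_snd ltac:(hyp 1).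
Qed.

Lemma trace1 : tracing 1.
Proof.
eexists; trace_cases => h x _; by_rule 1 [:: x].
by eapply r_pair; last triv; eapply r_pair; [hyp 0|triv].
Qed.

Lemma trace2 : tracing 2.
Proof.
eexists; trace_cases => h a b _; by_rule 2 [:: a; b].
eapply r_pair; last triv.
eapply r_pair; first by num_fst ltac:(hyp 0).
by eapply r_pair; [num_snd ltac:(hyp 0)|triv].
Qed.

Lemma trace3 : tracing 3.
Proof.
eexists; trace_cases => h a b _; by_rule 3 [:: a; b].
eapply r_pair; last triv.
eapply r_pair; first by num_fst ltac:(hyp 0).
by eapply r_pair; [num_snd ltac:(hyp 0)|triv].
Qed.

Lemma trace4 : tracing 4.
Proof.
eexists; trace_cases => h f g x a b runf rung _.
cut_by ltac:(num_fst ltac:(eapply r_csnd; hyp 1)).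
cut_by ltac:(num_snd ltac:(eapply r_csnd; hyp 2)).
call h.+1 h f x a runf; first by eapply r_pair; [eapply r_pair; [hyp 4|hyp 1]|hyp 2].
eapply r_exL => s; eapply r_prdL.
call h.+1 h g x b rung; first by eapply r_pair; [eapply r_pair; [hyp 6|hyp 2]|hyp 4].
eapply r_exL => t; eapply r_prdL.
by_rule 4 [:: f; g; x; a; b; s; t].
eapply r_pair.
  eapply r_pair; first hyp 5. eapply r_pair; first hyp 4.
  eapply r_pair; first hyp 6. eapply r_pair; first by lem node_out; hyp 3.
  eapply r_pair; first by lem node_out; hyp 1.
  eapply r_pair; first by lem node_sub; hyp 3.
  by eapply r_pair; [lem node_sub; hyp 1|triv].
by eapply r_pair; [hyp 2|eapply r_pair; [hyp 0|triv]].
Qed.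

Lemma trace5 : tracing 5.
Proof.
eexists; trace_cases => h f g x z y rung runf _.
cut_by ltac:(num_fst ltac:(eapply r_csnd; hyp 1)).
cut_by ltac:(num_snd ltac:(eapply r_csnd; hyp 2)).
call h.+1 h g x z rung; first by eapply r_pair; [eapply r_pair; [hyp 4|hyp 0]|hyp 2].
eapply r_exL => s; eapply r_prdL; cut_by ltac:(lem node_out; hyp 1).
call h.+1 h f z y runf; first by eapply r_pair; [eapply r_pair; [hyp 7|hyp 4]|hyp 0].
eapply r_exL => t; eapply r_prdL.
by_rule 5 [:: f; g; x; z; y; s; t].
eapply r_pair.
  eapply r_pair; first hyp 6. eapply r_pair; first hyp 5.
  eapply r_pair; first hyp 7. eapply r_pair; first hyp 2.
  eapply r_pair; first by lem node_out; hyp 1.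
  eapply r_pair; first by lem node_sub; hyp 4.
  by eapply r_pair; [lem node_sub; hyp 1|triv].
by eapply r_pair; [hyp 3|eapply r_pair; [hyp 0|triv]].
Qed.

Lemma trace7 : tracing 7.
Proof.
eexists; trace_cases => h f z y run _.
cut_by ltac:(num_fst ltac:(hyp 0)); cut_by ltac:(num_snd ltac:(hyp 1)).
call h.+1 h f z y run; first by eapply r_pair; [eapply r_pair; [hyp 4|hyp 1]|hyp 0].
eapply r_exL => s; eapply r_prdL.
(* Scheme 7 is rule 8, as primitive recursion occupies the two entries 6 and 7 of [comp_rules]. *)
by_rule 8 [:: f; z; y; s].
eapply r_pair; last by eapply r_pair; [hyp 0|triv].
eapply r_pair; first hyp 3. eapply r_pair; first hyp 2.
eapply r_pair; first by lem node_out; hyp 1.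
by eapply r_pair; [lem node_sub; hyp 1|triv].
Qed.

Lemma trace6 : tracing 6.
Proof.
eexists => h e x y run ek; move: run ek => run ek.
(* The recursion argument [csnd x] decides between the two rules of the scheme. *)
eapply (proj2_sig (r_case _ _ _) _ _ (csnd x)); last by eapply r_csnd; hyp 0.
  move=> x0; case: run ek x0; clear h e x y; try (by move=> >; rewrite cpair1);
    last by move=> >; rewrite cpair2.
  move=> h f g a y run _ _.
  cut_by ltac:(num_fst ltac:(eapply r_csnd; hyp 1)).
  cut_by ltac:(num_snd ltac:(eapply r_csnd; hyp 2)).
  cut_by ltac:(num_fst ltac:(hyp 2)).
  call h.+1 h f a y run; first by eapply r_pair; [eapply r_pair; [hyp 5|hyp 2]|hyp 0].
  eapply r_exL => s; eapply r_prdL.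
  by_rule 6 [:: f; g; a; y; s].
  eapply r_pair; last by eapply r_pair; [hyp 0|triv].
  eapply r_pair; first hyp 4. eapply r_pair; first hyp 3.
  eapply r_pair; first hyp 2.
  eapply r_pair; first by lem node_out; hyp 1.
  by eapply r_pair; [lem node_sub; hyp 1|triv].
move=> m xm; case: run ek xm; clear h e x y; try (by move=> >; rewrite cpair1);
  first by move=> >; rewrite cpair2.
move=> h f g a k z y run rung _; rewrite cpair2 => -[<-].
cut_by ltac:(num_fst ltac:(eapply r_csnd; hyp 2)).
cut_by ltac:(num_snd ltac:(eapply r_csnd; hyp 3)).
cut_by ltac:(num_fst ltac:(hyp 3)).
call h.+1 h (cpair 6 (cpair f g)) (cpair a k) z run.
  by eapply r_pair; [eapply r_pair; [hyp 6|hyp 5]|eapply r_cpair; [hyp 0|hyp 3]].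
eapply r_exL => s; eapply r_prdL; cut_by ltac:(lem node_out; hyp 1).
call h.+1 h g (cpair a (cpair k z)) y rung.
  eapply r_pair; first by eapply r_pair; [hyp 9|hyp 4].
  by eapply r_cpair; [hyp 3|eapply r_cpair; [hyp 6|hyp 0]].
eapply r_exL => t; eapply r_prdL.
by_rule 7 [:: f; g; a; k; z; y; s; t].
eapply r_pair.
  eapply r_pair; first hyp 7. eapply r_pair; first hyp 6.
  eapply r_pair; first hyp 5. eapply r_pair; first hyp 8.
  eapply r_pair; first hyp 2.
  eapply r_pair; first by lem node_out; hyp 1.
  eapply r_pair; first by lem node_sub; hyp 4.
  by eapply r_pair; [lem node_sub; hyp 1|triv].
by eapply r_pair; [hyp 3|eapply r_pair; [hyp 0|triv]].
Qed.

(** The extra input [cfst e - k] is a countdown that vanishes exactly at scheme [k], so that nested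
    tests for zero dispatch on the tag of [e]. *)
Definition tracing_from k := {c | forall h e x y, compn h e x y -> k <= cfst e ->
  ent (traced_below h ** num e ** num x ** num (cfst e - k)) c (traced (h, e, x, y))}.

Lemma tracing_step k : tracing k -> tracing_from k.+1 -> tracing_from k.
Proof.
move=> [c Hc] [d Hd]; eexists => h e x y run ke.
eapply (proj2_sig (r_case _ _ _) _ _ (cfst e - k)); last by hyp 0.
  move=> /eqP ek; eapply r_lem; last exact: r_drop.
  by apply: Hc => //; apply/eqP; rewrite eqn_leq ke andbT.
move=> m em; eapply r_lem; first apply: Hd => //.
  by rewrite -subn_gt0 em.
eapply r_pair; first by eapply r_wk; exact: r_drop.
by rewrite subnS em; hyp 0.
Qed.

(** No computation has a program with tag 8 or more, so an arbitrary code will do. *)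
Lemma tracing_done : tracing_from 8.
Proof.
exists 0; move=> h e x y run.
by case: run; move=> >; rewrite cpair1.
Qed.

Lemma ltn_wf : well_founded (fun m n : nat => m < n).
Proof.
suff H k : forall n : nat, n < k -> Acc (fun m n : nat => m < n) n.
  by move=> n; exact: (H n.+1).
elim: k => [//|k IH] n nk; apply: Acc_intro => m mn.
by apply: IH; exact: leq_trans mn nk.
Qed.

(** [r_fix] on the height, which proves termination but does not enter the program. *)
Lemma trace : {c | forall h e x y, compn h e x y ->
  ent (num e ** num x) c (traced (h, e, x, y))}.
Proof.
have [c Hc] : tracing_from 0.
  by do ![exact: tracing_done | apply: tracing_step;
    first by [exact: trace0|exact: trace1|exact: trace2|exact: trace3
             |exact: trace4|exact: trace5|exact: trace6|exact: trace7]].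
eexists => h e x y run.
eapply (@r_app _ (called (h, e, x, y))).
  eapply r_lem; last triv.
  eapply (@r_fix _ _ (fun p : nat * nat * nat * nat => p.1.1.1) _ called traced _ _ ltn_wf).
  move=> [[[h' e'] x'] y'] /=; eapply r_lam; eapply r_exL => run'; eapply r_prdL.
  eapply r_lem; first exact: Hc run' _.
  eapply r_pair; first by eapply r_pair; [eapply r_pair; [hyp 2|hyp 1]|hyp 0].
  by rewrite subn0; eapply r_cfst; hyp 1.
by eapply (@r_exI _ _ _ _ run); exact: r_id.
Qed.

Lemma value_nums t : {d | forall ws p x r D,
  all (fun i => i < size ws) (pvars t) ->
  (forall i, i < size ws -> r (p i) = nm (nth 0 ws i)) ->
  r x = nm (peval (nth 0 ws) t) -> ent (nums ws) d (sat (is_value p t x) r D)}.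
Proof.
eexists => ws p x r D /allP st Hw rx.
apply: (svalP (value_real t proj) _ (nth 0 ws)) => // i /st iws.
  exact: nums_nth.
exact: Hw.
Qed.

(** * Epistemic Church's Thesis *)

Definition ECT_conclusion (f : form) : form :=
  ex_nat (ex_nat (FAnd (kleene_T 3 2 0) (FAnd (kleene_U 0 1)
    (FBox (ren (fun k => match k with 0 => 1 | 1 => 2 | k'.+2 => k'.+4 end) f))))).

(* At the answer type [pex (F k)] the premise gives a computable choice
   function. *)
Lemma ECT_reduction f g :
  {c | forall r e k j E, comp e k j ->
    ent (num e ** num k ** (num j ** bx f (nm j .: nm k .: r))) c
        (sat g (nm k .: nm e .: r) E)} ->
  valid (FImp (FBox (all_nat (ex_nat (FBox f)))) (ex_nat (FBox (all_nat g)))).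
Proof.
move=> [c Hc]; eexists => r D; eapply r_lam; eapply n_bind; first hyp 0.
pose F k j := num j ** bx f (nm j .: nm k .: r).
cut_by ltac:(eapply (@r_lamA _ _ num (fun k => pex (F k)))).
  move=> k; eapply n_run; set A := pex _.
  eapply n_bind.
    eapply r_app; first by inst2 1 A (nm k).
    by eapply r_lem; [exact: (svalP nat_real 0 (nm k .: r) k A erefl)|hyp 0].
  eapply r_exL => m; eapply r_prdL.
  eapply n_bind; first by lem nat_in_omega; hyp 1.
  eapply n_bind; first by hyp 1.
  cut_by ltac:(hyp 1).
  eapply r_exL => j; eapply r_prdL; eapply n_ret; eapply (@r_exI _ _ _ _ j).
  eapply r_pair; first by hyp 1.
  eapply r_allP => E; lem (sat_eqv0 f); eapply r_pair; first by hyp 0.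
  by inst1 2 E.
(* The choice function [p] returns a number paired with a realizer of the boxed formula, so [e]
   keeps the first component. As [p] is now a number, the index [e] is computed from it; the
   constant 5 below is the tag of composition. *)
eapply r_reify => p Hp; pose e := cComp cFst p.
cut_by ltac:(eapply (@r_cpair _ 5 (cpair cFst p));
  [exact: r_const|eapply r_cpair; [exact: r_const|hyp 0]]).
rewrite -/(cComp cFst p) -/e.
eapply n_ret; eapply (@r_exI _ _ _ _ (nm e)); eapply r_pair.
  by eapply r_lem; [exact: (svalP nat_real 0 (nm e .: r) e D erefl)|hyp 0].
eapply n_ret; eapply r_allP => E; eapply r_allN => n; eapply r_lam.
eapply s_bind; first by lem nat_in_omega; hyp 0.
eapply r_exL => k; eapply r_prdL.
have [b pkb [j [bj Fb]]] := Hp k k erefl.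
lem (sat_eqv0 g); eapply r_pair; first by lem eqv_sym; hyp 0.
have ekj : comp e k j by apply: comp_comp pkb _; rewrite -bj; exact: comp_fst.
eapply r_lem; first exact: Hc ekj.
eapply r_pair; first by eapply r_pair; [hyp 3|hyp 1].
eapply r_app; last by hyp 1.
eapply r_lem; last by hyp 4.
apply: r_num => m ->; exists b => //; split => //.
Qed.

Lemma valid_ECT f : valid (ECT_instance f).
Proof.
apply: (@ECT_reduction f (ECT_conclusion f)).
eexists => r e k j E [h run].
cut_by ltac:(eapply r_lem; [exact: (svalP trace h e k j run)|exact: r_drop]).
eapply r_exL => s; eapply r_prdL; set q := node e k j s.
pose env0 := nm q .: nm j .: nm k .: nm e .: r.
(* The numbers are listed as the variables in scope inside [kleene_T]: s, y, q, m, n, e. The output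
   [j] occurs both as y and as m. *)
eapply (@r_cut _ (nums [:: s; j; q; j; k; e])).
  eapply r_pair; first by lem node_sub; hyp 1.
  eapply r_pair; first by eapply r_fst; hyp 2.
  eapply r_pair; first by hyp 1.
  eapply r_pair; first by eapply r_fst; hyp 2.
  eapply r_pair; first by hyp 3.
  by eapply r_pair; [hyp 4|triv].
eapply n_ret; eapply (@r_exI _ _ _ _ (nm j)); eapply r_pair.
  eapply r_lem; first exact: (svalP nat_real 0 (nm j .: nm k .: nm e .: r) j E erefl).
  by eapply r_fst; hyp 3.
eapply n_ret; eapply (@r_exI _ _ _ _ (nm q)); eapply r_pair.
  by eapply r_lem; [exact: (svalP nat_real 0 env0 q E erefl)|hyp 2].
eapply r_pair; last eapply r_pair.
- eapply r_pair.
    eapply r_lem; first exact: (svalP least_in comp_closed 0 env0 E).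
    eapply r_lamA => u; eapply r_app; last by hyp 0.
    by inst1 2 (env0, u).
  eapply n_ret; eapply (@r_exI _ _ _ _ (nm j)).
  eapply n_ret; eapply (@r_exI _ _ _ _ (nm s)).
  eapply r_lem; last by hyp 0.
  apply: (svalP (value_nums (comp_node (PVar 5) (PVar 4) (PVar 1) (PVar 0)))
    [:: s; j; q; j; k; e] id 2 (nm s .: nm j .: env0) E) => //.
  by case=> [|[|[|[|[|[|]]]]]].
- eapply n_ret; eapply (@r_exI _ _ _ _ (nm e)).
  eapply n_ret; eapply (@r_exI _ _ _ _ (nm k)).
  eapply n_ret; eapply (@r_exI _ _ _ _ (nm s)).
  (* Inside [kleene_U] the three innermost variables are s, the input [k] and the program [e],
     followed by those of [env0]. *)
  cut_by ltac:(idtac).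
    eapply (@r_pair _ (num s) (nums [:: k; e; q; j; k; e])).
      by eapply r_fst; hyp 0.
    eapply r_pair; first by hyp 4.
    eapply r_pair; first by hyp 5.
    by eapply r_snd; eapply r_snd; hyp 0.
  eapply r_lem; last by hyp 0.
  apply: (svalP (value_nums (comp_node (PVar 2) (PVar 1) (PVar 4) (PVar 0)))
    [:: s; k; e; q; j; k; e] id 3 (nm s .: nm k .: nm e .: env0) E) => //.
  by case=> [|[|[|[|[|[|[|]]]]]]].
- eapply n_ret; eapply r_allP => E'.
  eapply r_eq; first by inst_by E' ltac:(eapply r_snd; hyp 3).
  have Es : sat (ren (fun k => match k with 0 => 1 | 1 => 2 | k'.+2 => k'.+4 end) f) env0
      = sat f (nm j .: nm k .: r).
    by rewrite sat_ren; congr sat; apply/funext => -[|[|i]].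
  exact (congr1 (fun A => A E') (esym Es)).
Qed.

Lemma valid_eZF f : eZF f -> valid f.
Proof.
case=> {f} [|f|||f|||u f].
- exact: valid_extensionality.
- exact: valid_foundation.
- exact: valid_pairing.
- exact: valid_unions.
- exact: valid_comprehension.
- exact: valid_power_set.
- exact: valid_infinity.
- exact: valid_collection.
Qed.

(** * Stability of atomics and its failure for negated atomics *)

Lemma valid_atomic_stability f : stability atomic f -> valid f.
Proof.
move=> [g [n [[x [y]] gxy _ ->]]]; apply: valid_nec.
elim: n => [|n IH]; last exact: valid_gen.
(* Beneath its double negation, the truth value of an atom does not depend on the answer type, so
   once unwrapped it serves for every [E]. *)
by case: gxy => ->; eexists => r D; eapply r_lam; (eapply n_bind; first hyp 0);
  (eapply n_ret; eapply r_allP => E; eapply n_ret; hyp 0).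
Qed.

Definition nonmem_stable : form := (∀' ∀' (¬ (0 ∈ 1) ⇒ □ ¬ (0 ∈ 1)))%modal.

(* Given [t 1] and the constant function [0], a realizer would have to answer
   [0] when the truth value of the atom is empty and [1] when it is inhabited. *)
Lemma nonmem_stable_unrealized r n : ~ bx nonmem_stable r n.
Proof.
(* [t w] runs its argument on the constant program [cConst w], which turns a constant refutation of
   the atom into a realizer of its negation. *)
move=> H; pose t w := cApp cId (cConst (cConst w)).
have const_imp (A : pr) v : (A ~> num v) (cConst v).
  by move=> a _; exists v => //; exact: comp_const.
have t_imp y v w : (mem empty y ~> num v) (cConst w) ->
    (nn (num v) (mem empty y) ~> num v) (t w).
  move=> Aw c /(_ _ Aw)[z cz vz]; exists z => //.
  exact: comp_app (comp_id _) (comp_const _ _) cz.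
(* At answer type [num 0] with the empty set, the atom has no realizers, so [t 1] realizes its
   negation vacuously; the continuation [cConst 0] forces the answer 0. *)
have [b nb bv] : exists2 b, comp n (t 1) b & comp b (cConst 0) 0.
  have [|b nb /(_ (cConst 0))[|z bz z0]] := H (num 0) empty empty (t 1).
  - by apply: t_imp => a [[]].
  - exact: const_imp.
  - by exists b => //; rewrite z0 in bz.
have [a Aa] : exists a, mem empty (upair empty empty) a.
  have [a _ Aa] := svalP eqv_refl tt empty 0 Logic.I.
  by exists (cpair 0 a); exists true; split; rewrite (cpair1, cpair2).
(* At answer type [num 1] with a nonempty set, the boxed negation has no realizers, so [cConst 0] is
   vacuously a continuation and the answer must be 1. The inputs are the same as before, which
   contradicts determinism. *)
have [|b' nb' /(_ (cConst 0))[|z bz z0]] := H (num 1) (upair empty empty) empty (t 1).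
- exact: t_imp.
- move=> c /(_ (fun=> False) 0)[] // d /(_ _ Aa)[? _ []].
- by rewrite z0 -(comp_fun nb nb') in bz; have := comp_fun bv bz.
Qed.

Lemma valid_nonmem_unstable : valid (FImp (FBox nonmem_stable) FBot).
Proof.
eexists => r D; eapply r_lam; eapply n_elim; first hyp 0.
(* The hypothesis has no realizers, so any program works; [0] is taken. *)
move=> c [_ /nonmem_stable_unrealized H]; exact: (False_ind (exists2 b, comp 0 _ b & D b) H).
Qed.

Theorem theorem1p5 :
  (exists K : Type, uncountable_strongly_inaccessible K) ->
  exists σ : form,
    stability negated_atomic σ /\
    consistent (fun φ =>
      eZF φ \/ ECT φ \/ stability atomic φ \/ φ = FImp σ FBot).
Proof.
move=> _; exists (FBox nonmem_stable); split.
  exists (¬ (0 ∈ 1))%modal, 2; split=> //.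
  by exists (0 ∈ 1)%modal => //; exists 0, 1; left.
apply: consistency => f [/valid_eZF //|[[g ->]|[/valid_atomic_stability //|->]]].
  exact: valid_ECT.
exact: valid_nonmem_unstable.
Qed.
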